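(* The calculus $\mathcal{H}\mathbf{K}\mathsf{biG}^{\mathsf{f}}$ is strongly complete: for every set $\Gamma\cup\{\phi\}\subseteq\mathcal{L}_{\triangle,\Box,\lozenge}$ (not necessarily finite), $\Gamma\models_{\mathbf{K}\mathsf{biG}^{\mathsf{f}}}\phi$ if and only if $\Gamma\vdash_{\mathcal{H}\mathbf{K}\mathsf{biG}^{\mathsf{f}}}\phi$.
   Context: Gödel operations on $[0,1]$: $a\wedge_G b=\min(a,b)$, $a\vee_G b=\max(a,b)$, $a\to_G b=1$ if $a\le b$ and $=b$ otherwise; ${\sim}_G a=1$ if $a=0$ and $0$ otherwise; $\triangle_G a=1$ if $a=1$ and $0$ otherwise. The language $\mathcal{L}_{\triangle,\Box,\lozenge}$ is generated from a countable set $\mathtt{Prop}$ of variables by $\phi::=p\mid{\sim}\phi\mid\triangle\phi\mid(\phi\wedge\phi)\mid(\phi\vee\phi)\mid(\phi\to\phi)\mid\Box\phi\mid\lozenge\phi$; $\mathbf 1:=p\to p$, $\mathbf 0:={\sim}\mathbf 1$. A fuzzy frame is $\langle W,R\rangle$ with $W\neq\emptyset$, $R:W\times W\to[0,1]$ (crisp frames, where $R$ takes values in $\{0,1\}$, are included). A model adds $e:\mathtt{Prop}\times W\to[0,1]$, extended by applying the Gödel operations pointwise to ${\sim},\triangle,\wedge,\vee,\to$, and $e(\Box\phi,w)=\inf_{w'\in W}(wRw'\to_G e(\phi,w'))$, $e(\lozenge\phi,w)=\sup_{w'\in W}(wRw'\wedge_G e(\phi,w'))$. $\Gamma\models_{\mathbf{K}\mathsf{biG}^{\mathsf{f}}}\chi$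 means: for every model on a fuzzy frame and every state $w$, $\inf\{e(\psi,w):\psi\in\Gamma\}\le e(\chi,w)$. The calculus $\mathcal{H}\mathsf{G}\triangle$ (for propositional bi-Gödel logic) has axiom schemas: (1) $(\phi\to\chi)\to((\chi\to\psi)\to(\phi\to\psi))$; (2) $\phi\to(\phi\vee\chi)$, $\chi\to(\phi\vee\chi)$, $(\phi\to\psi)\to((\chi\to\psi)\to((\phi\vee\chi)\to\psi))$; (3) $(\phi\wedge\chi)\to\phi$, $(\phi\wedge\chi)\to\chi$, $(\phi\to\chi)\to((\phi\to\psi)\to(\phi\to(\chi\wedge\psi)))$; (4) $(\phi\to(\chi\to\psi))\to((\phi\wedge\chi)\to\psi)$, $((\phi\wedge\chi)\to\psi)\to(\phi\to(\chi\to\psi))$; (5) ${\sim}\phi\to(\phi\to\chi)$; (6) $(\phi\to\chi)\vee(\chi\to\phi)$; (7) $\triangle\phi\vee{\sim}\triangle\phi$; (8) $\triangle(\phi\to\chi)\to(\triangle\phi\to\triangle\chi)$, $\triangle(\phi\vee\chi)\to(\triangle\phi\vee\triangle\chi)$; (9) $\triangle\phi\to\phi$, $\triangle\phi\to\triangle\triangle\phi$; rules modus ponens and $\triangle$-necessitation (from $\vdash\phi$ infer $\vdash\triangle\phi$). The calculus $\mathcal{H}\mathbf{K}\mathsf{biG}^{\mathsf{f}}$ has: all substitution instances (in $\mathcal{L}_{\triangle,\Box,\lozenge}$) of theorems and rules of $\mathcal{H}\mathsf{G}\triangle$; the axioms ${\sim}\lozenge\mathbf 0$; $\Box(\phi\to\chi)\to(\Box\phi\to\Box\chi)$;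 $\lozenge(\phi\vee\chi)\to(\lozenge\phi\vee\lozenge\chi)$; $\lozenge(\phi\to\chi)\to(\Box\phi\to\lozenge\chi)$; $(\lozenge\phi\to\Box\chi)\to\Box(\phi\to\chi)$; and the rules: from $\vdash\phi$ infer $\vdash\Box\phi$; from $\vdash\phi\to\chi$ infer $\vdash\lozenge\phi\to\lozenge\chi$. $\Gamma\vdash_{\mathcal{H}\mathbf{K}\mathsf{biG}^{\mathsf{f}}}\chi$ means there is a finite sequence ending in $\chi$ each member of which is in $\Gamma$, an axiom instance, obtained by modus ponens from earlier members, or obtained by $\triangle$-necessitation, $\Box$-necessitation or the $\lozenge$-rule from an earlier member that does not depend on $\Gamma$ (i.e., these rules are applied only to theorems).
   Formalization: The axiom schema (φ→0)→∼φ is added to HG△: with ∼ primitive, the listed axioms and rules do not derive the valid formula ∼∼(p→p), so the calculus as listed is not complete. *)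

(* Defs.v *)
From mathcomp Require Import all_boot all_order all_algebra.
From mathcomp Require Import boolp classical_sets reals.

Set Implicit Arguments.
Unset Strict Implicit.
Unset Printing Implicit Defensive.

Import Order.TTheory GRing.Theory Num.Theory.
Local Open Scope classical_set_scope.
Local Open Scope ring_scope.

(** * Languages *)

Inductive pfml : Type :=
| PVar of nat
| PNeg of pfml
| PTri of pfml
| PAnd of pfml & pfml
| POr of pfml & pfml
| PImp of pfml & pfml.

Inductive fml : Type :=
| Var of nat
| Neg of fml
| Tri of fml
| And of fml & fml
| Or of fml & fml
| Imp of fml & fml
| Box of fml
| Dia of fml.

Declare Scope pfml_scope.
Delimit Scope pfml_scope with P.
Bind Scope pfml_scope with pfml.
Declare Scope fml_scope.
Delimit Scope fml_scope with F.
Bind Scope fml_scope with fml.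

Reserved Notation "∼ a" (at level 35, right associativity).
Reserved Notation "△ a" (at level 35, right associativity).
Reserved Notation "□ a" (at level 35, right associativity).
Reserved Notation "◇ a" (at level 35, right associativity).
Reserved Notation "a ⊓ b" (at level 40, left associativity).
Reserved Notation "a ⊔ b" (at level 50, left associativity).
Reserved Notation "a ⊃ b" (at level 55, right associativity).

Notation "∼ a" := (PNeg a) : pfml_scope.
Notation "△ a" := (PTri a) : pfml_scope.
Notation "a ⊓ b" := (PAnd a b) : pfml_scope.
Notation "a ⊔ b" := (POr a b) : pfml_scope.
Notation "a ⊃ b" := (PImp a b) : pfml_scope.

Notation "∼ a" := (Neg a) : fml_scope.
Notation "△ a" := (Tri a) : fml_scope.
Notation "a ⊓ b" := (And a b) : fml_scope.
Notation "a ⊔ b" := (Or a b) : fml_scope.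
Notation "a ⊃ b" := (Imp a b) : fml_scope.
Notation "□ a" := (Box a) : fml_scope.
Notation "◇ a" := (Dia a) : fml_scope.

Definition ptop : pfml := (PVar 0 ⊃ PVar 0)%P.
Definition pbot : pfml := (∼ ptop)%P.
Definition ftop : fml := (Var 0 ⊃ Var 0)%F.
Definition fbot : fml := (∼ ftop)%F.

Fixpoint psubst (s : nat -> fml) (a : pfml) : fml :=
  match a with
  | PVar p => s p
  | PNeg a => Neg (psubst s a)
  | PTri a => Tri (psubst s a)
  | PAnd a b => And (psubst s a) (psubst s b)
  | POr a b => Or (psubst s a) (psubst s b)
  | PImp a b => Imp (psubst s a) (psubst s b)
  end.

(** * Semantics *)

Section Goedel.
Variable R : realType.
Implicit Types a b : R.

Definition gand a b : R := Num.min a b.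
Definition gor a b : R := Num.max a b.
Definition gimp a b : R := if a <= b then 1 else b.
Definition gneg a : R := if a == 0 then 1 else 0.
Definition gtri a : R := if a == 1 then 1 else 0.

(* The infimum taken in the lattice [0, 1], so that the empty infimum is 1
   (whereas [inf set0 = 0]). *)
Definition inf01 (A : set R) : R := inf (1 |` A).

End Goedel.

Record fuzzy_frame (R : realType) := FuzzyFrame {
  state :> Type;
  state_nonempty : inhabited state;
  acc : state -> state -> R;
  acc01 : forall w w', 0 <= acc w w' <= 1
}.

Record model (R : realType) := Model {
  model_frame :> fuzzy_frame R;
  valu : nat -> model_frame -> R;
  valu01 : forall p w, 0 <= valu p w <= 1
}.

Fixpoint eval (R : realType) (M : model R) (a : fml) (w : M) : R :=
  match a with
  | Var p => valu p w
  | Neg a => gneg (eval a w)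
  | Tri a => gtri (eval a w)
  | And a b => gand (eval a w) (eval b w)
  | Or a b => gor (eval a w) (eval b w)
  | Imp a b => gimp (eval a w) (eval b w)
  | Box a => inf [set gimp (acc w w') (eval a w') | w' in [set: M]]
  | Dia a => sup [set gand (acc w w') (eval a w') | w' in [set: M]]
  end.

Definition entails (R : realType) (Gamma : set fml) (chi : fml) : Prop :=
  forall (M : model R) (w : M),
    inf01 [set eval psi w | psi in Gamma] <= eval chi w.

(** * Hilbert calculi *)

Inductive HGtri_axiom : pfml -> Prop :=
| ax_trans a b c : HGtri_axiom ((a ⊃ b) ⊃ ((b ⊃ c) ⊃ (a ⊃ c)))
| ax_orl a b : HGtri_axiom (a ⊃ (a ⊔ b))
| ax_orr a b : HGtri_axiom (b ⊃ (a ⊔ b))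
| ax_or_elim a b c : HGtri_axiom ((a ⊃ c) ⊃ ((b ⊃ c) ⊃ ((a ⊔ b) ⊃ c)))
| ax_andl a b : HGtri_axiom ((a ⊓ b) ⊃ a)
| ax_andr a b : HGtri_axiom ((a ⊓ b) ⊃ b)
| ax_and_intro a b c : HGtri_axiom ((a ⊃ b) ⊃ ((a ⊃ c) ⊃ (a ⊃ (b ⊓ c))))
| ax_uncurry a b c : HGtri_axiom ((a ⊃ (b ⊃ c)) ⊃ ((a ⊓ b) ⊃ c))
| ax_curry a b c : HGtri_axiom (((a ⊓ b) ⊃ c) ⊃ (a ⊃ (b ⊃ c)))
| ax_neg_elim a b : HGtri_axiom (∼ a ⊃ (a ⊃ b))
(* Usually left implicit, by reading [∼ a] as [a ⊃ 0].  As [∼] is a primitive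
   connective here, it has to be stated: the other axioms and rules do not
   derive the valid formula [∼ ∼ (p ⊃ p)]. *)
| ax_neg_intro a : HGtri_axiom ((a ⊃ pbot) ⊃ ∼ a)
| ax_prelin a b : HGtri_axiom ((a ⊃ b) ⊔ (b ⊃ a))
| ax_tri_em a : HGtri_axiom (△ a ⊔ ∼ △ a)
| ax_tri_K a b : HGtri_axiom (△ (a ⊃ b) ⊃ (△ a ⊃ △ b))
| ax_tri_or a b : HGtri_axiom (△ (a ⊔ b) ⊃ (△ a ⊔ △ b))
| ax_tri_T a : HGtri_axiom (△ a ⊃ a)
| ax_tri_4 a : HGtri_axiom (△ a ⊃ △ △ a).

Inductive HGtri_thm : pfml -> Prop :=
| HGtri_ax a : HGtri_axiom a -> HGtri_thm a
| HGtri_mp a b : HGtri_thm a -> HGtri_thm (a ⊃ b) -> HGtri_thm b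
| HGtri_nec a : HGtri_thm a -> HGtri_thm (△ a).

Inductive HKbiG_axiom : fml -> Prop :=
| ax_HGtri (s : nat -> fml) (a : pfml) :
    HGtri_thm a -> HKbiG_axiom (psubst s a)
| ax_dia_bot : HKbiG_axiom (∼ ◇ fbot)
| ax_box_K a b : HKbiG_axiom (□ (a ⊃ b) ⊃ (□ a ⊃ □ b))
| ax_dia_or a b : HKbiG_axiom (◇ (a ⊔ b) ⊃ (◇ a ⊔ ◇ b))
| ax_FS1 a b : HKbiG_axiom (◇ (a ⊃ b) ⊃ (□ a ⊃ ◇ b))
| ax_FS2 a b : HKbiG_axiom ((◇ a ⊃ □ b) ⊃ □ (a ⊃ b)).

(* The rules other than modus ponens apply to theorems only, that is, to
   formulas derivable from the empty set of assumptions. *)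
Inductive derives : set fml -> fml -> Prop :=
| der_hyp (Gamma : set fml) a : Gamma a -> derives Gamma a
| der_ax Gamma a : HKbiG_axiom a -> derives Gamma a
| der_mp Gamma a b : derives Gamma a -> derives Gamma (a ⊃ b)%F ->
    derives Gamma b
| der_tri Gamma a : derives set0 a -> derives Gamma (△ a)%F
| der_box Gamma a : derives set0 a -> derives Gamma (□ a)%F
| der_dia Gamma a b : derives set0 (a ⊃ b)%F ->
    derives Gamma (◇ a ⊃ ◇ b)%F.

(* Main.v *)
(* A valuation of the formulas at a state of a model amounts to a linear preorder
   of the formulas, and the linear preorders so obtained syntactically are those
   given by [a ⊃ b \in G], where [G = {a | △ a \in F}] for a prime theory [F].
   If [phi] is not derivable from [Gamma], we start from a prime theory [F]
   that contains [Gamma] but not [phi], and grow a countable tree of such states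
   together with a single linear preorder on all truth values and all degrees of
   accessibility. A step adds one child that witnesses [□ a] (or [◇ a]) up to the
   points present so far: the values of the child are merged into the
   chain around a cut placed just above the value of [□ a] (just below that of
   [◇ a]), and the degree of accessibility of the child is a new point in the cut.
   In the limit the values of [□ a] and [◇ a] are the infimum and supremum
   required, in the chain; inserting the points of the chain into [0, 1] one by
   one, each in the middle of its gap, preserves all infima and suprema. A new
   point separating [F] from its complement bounds [Gamma] from below and is
   strictly above [phi]. *)
Require Import Defs.
From HB Require Import structures.
From mathcomp Require Import all_boot all_order all_algebra.
From mathcomp Require Import boolp classical_sets reals.
From mathcomp Require Import ring lra zify.

Set Implicit Arguments.
Unset Strict Implicit.
Unset Printing Implicit Defensive.

Import Order.TTheory GRing.Theory Num.Theory.
Local Open Scope classical_set_scope.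
Local Open Scope fml_scope.

(** * Theories and prime theories *)

Definition theory (T : set fml) : Prop :=
  (forall a, derives set0 a -> T a) /\
  (forall a b, T a -> T (a ⊃ b) -> T b).

Lemma derives_mono (Gamma Delta : set fml) a :
  Gamma `<=` Delta -> derives Gamma a -> derives Delta a.
Proof.
move=> + d; elim: d Delta => {Gamma a}
  [? a Ga|? a ax|? a b _ IHa _ IHab|? a da _|? a da _|? a b dab _] Delta GD.
- exact/der_hyp/GD.
- exact: der_ax.
- by apply: der_mp (IHa _ GD) (IHab _ GD).
- exact: der_tri.
- exact: der_box.
- exact: der_dia.
Qed.

Lemma theory_derives (Gamma : set fml) : theory (derives Gamma).
Proof.
by split=> [a|a b]; [apply: derives_mono | apply: der_mp].
Qed.

(** A finite list stands for a substitution, so that an axiom on the variables 0, 1, 2 is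
    instantiated by listing formulas. *)
Definition inst (s : seq fml) (n : nat) : fml := nth (Var 0) s n.

Lemma derives_HG (s : seq fml) (a : pfml) :
  HGtri_axiom a -> derives set0 (psubst (inst s) a).
Proof. by move=> ax; apply/der_ax/ax_HGtri/HGtri_ax. Qed.

Section InTheory.
Variables (T : set fml) (tT : theory T).

Lemma thm_in a : derives set0 a -> T a.
Proof. exact: tT.1. Qed.

Lemma mp a b : T (a ⊃ b) -> T a -> T b.
Proof. by move=> hab ha; apply: tT.2 ha hab. Qed.

Lemma HG_in s a : HGtri_axiom a -> T (psubst (inst s) a).
Proof. by move=> ax; apply/thm_in/derives_HG. Qed.

Lemma in_trans a b c : T (a ⊃ b) -> T (b ⊃ c) -> T (a ⊃ c).
Proof.
move=> ab; apply: mp; apply: mp ab.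
exact: (HG_in [:: a; b; c] (ax_trans (PVar 0) (PVar 1) (PVar 2))).
Qed.

Lemma in_andl a b : T (a ⊓ b ⊃ a).
Proof. exact: (HG_in [:: a; b] (ax_andl (PVar 0) (PVar 1))). Qed.

Lemma in_andr a b : T (a ⊓ b ⊃ b).
Proof. exact: (HG_in [:: a; b] (ax_andr (PVar 0) (PVar 1))). Qed.

Lemma in_orl a b : T (a ⊃ a ⊔ b).
Proof. exact: (HG_in [:: a; b] (ax_orl (PVar 0) (PVar 1))). Qed.

Lemma in_orr a b : T (b ⊃ a ⊔ b).
Proof. exact: (HG_in [:: a; b] (ax_orr (PVar 0) (PVar 1))). Qed.

Lemma in_or_elim a b c : T (a ⊃ c) -> T (b ⊃ c) -> T (a ⊔ b ⊃ c).
Proof.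
move=> ac; apply: mp; apply: mp ac.
exact: (HG_in [:: a; b; c] (ax_or_elim (PVar 0) (PVar 1) (PVar 2))).
Qed.

Lemma in_and_intro a b c : T (a ⊃ b) -> T (a ⊃ c) -> T (a ⊃ b ⊓ c).
Proof.
move=> ab; apply: mp; apply: mp ab.
exact: (HG_in [:: a; b; c] (ax_and_intro (PVar 0) (PVar 1) (PVar 2))).
Qed.

Lemma in_curry a b c : T (a ⊓ b ⊃ c) -> T (a ⊃ b ⊃ c).
Proof.
apply: mp.
exact: (HG_in [:: a; b; c] (ax_curry (PVar 0) (PVar 1) (PVar 2))).
Qed.

Lemma in_uncurry a b c : T (a ⊃ b ⊃ c) -> T (a ⊓ b ⊃ c).
Proof.
apply: mp.
exact: (HG_in [:: a; b; c] (ax_uncurry (PVar 0) (PVar 1) (PVar 2))).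
Qed.

Lemma in_K a b : T (a ⊃ b ⊃ a).
Proof. exact/in_curry/in_andl. Qed.

Lemma in_id a : T (a ⊃ a).
Proof.
by apply: (mp (a := a ⊓ a ⊃ a)); [apply/in_curry/in_andr | apply: in_andl].
Qed.

Lemma in_const a b : T b -> T (a ⊃ b).
Proof. exact/mp/in_K. Qed.

Lemma in_ftop : T ftop.
Proof. exact: in_id. Qed.

Lemma in_neg_elim a b : T (∼ a ⊃ a ⊃ b).
Proof. exact: (HG_in [:: a; b] (ax_neg_elim (PVar 0) (PVar 1))). Qed.

Lemma in_neg_intro a : T (a ⊃ fbot) -> T (∼ a).
Proof.
(* [pbot] is built from the variable 0, which must go to [Var 0] for its instance to be [fbot];
   hence [a] sits at position 1. *)
by apply: mp; apply: (HG_in [:: Var 0; a] (ax_neg_intro (PVar 1))).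
Qed.

Lemma in_prelin a b : T ((a ⊃ b) ⊔ (b ⊃ a)).
Proof. exact: (HG_in [:: a; b] (ax_prelin (PVar 0) (PVar 1))). Qed.

Lemma theory_adjoin a : theory [set b | T (a ⊃ b)].
Proof.
split=> [b /thm_in|b c /= ab abc]; first exact: in_const.
exact: in_trans (in_and_intro (in_id a) ab) (in_uncurry abc).
Qed.

(** Deduction theorem: [[set b | T (a ⊃ b)]] is itself a theory containing [T] and [a]. Implications
    can then be proved in natural-deduction style, by reasoning in larger theories. *)
Lemma imp_intro a b :
  (forall U, theory U -> T `<=` U -> U a -> U b) -> T (a ⊃ b).
Proof.
move=> /(_ _ (theory_adjoin a)); apply; last exact: in_id.
by move=> c Tc; apply: in_const.
Qed.

End InTheory.

Lemma in_exfalso T a : theory T -> T (fbot ⊃ a).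
Proof.
move=> tT; apply: imp_intro => // U tU _ /(mp tU (in_neg_elim tU _ a)).
by move/(mp tU); apply; apply: in_ftop.
Qed.

(* The connective [⊃] is a Gödel implication: its value is 1 or that of the
   conclusion. *)
Lemma in_imp_or T a b : theory T -> T ((a ⊃ b) ⊔ ((a ⊃ b) ⊃ b)).
Proof.
(* Prelinearity for [a] and [a ⊃ b]: contraction turns [a ⊃ (a ⊃ b)] into [a ⊃ b], and [(a ⊃ b) ⊃ a]
   into [(a ⊃ b) ⊃ b]. *)
move=> tT; apply: (mp tT) (in_prelin tT a (a ⊃ b)); apply: in_or_elim => //.
- apply: imp_intro => // U tU _ aab; apply: (mp tU (in_orl tU _ _)).
  by apply: imp_intro => // V tV UV Va; apply/(mp tV _ Va)/(mp tV (UV _ aab)).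
- apply: imp_intro => // U tU _ aba; apply: (mp tU (in_orr tU _ _)).
  apply: imp_intro => // V tV UV Vab; apply: (mp tV Vab).
  exact: mp (UV _ aba) Vab.
Qed.

Definition prime_theory (F : set fml) : Prop :=
  [/\ theory F, forall a b, F (a ⊔ b) -> F a \/ F b & ~ F fbot].

(** A theory maximal among those avoiding [I] is prime: two formulas outside it each imply an
    element of [I], hence so does their disjunction, [I] being directed under derivable
    implication. *)
Lemma prime_extension (T I : set fml) :
  theory T -> (forall a, T a -> ~ I a) -> I !=set0 ->
  (forall a b, I a -> I b -> exists c,
     [/\ I c, derives set0 (a ⊃ c) & derives set0 (b ⊃ c)]) ->
  exists F, [/\ prime_theory F, T `<=` F & forall a, F a -> ~ I a].
Proof.
move=> tT TI [i0 Ii0] dirI.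
(* The disjunct [A = set0] admits the union of the empty chain, as [Zorn_bigcup] demands. *)
pose P A := A = set0 \/ [/\ theory A, T `<=` A & forall a, A a -> ~ I a].
have [C CP Ctot|F [PF maxF]] := @Zorn_bigcup _ P.
  have [[A0 CA0 A0n]|C0] := pselect (exists2 A, C A & A !=set0); last first.
    left; rewrite -subset0 => a [A CA Aa]; apply: C0; exists A => //.
    by exists a.
  have CE A a : C A -> A a -> [/\ theory A, T `<=` A & forall a, A a -> ~ I a].
    by move=> CA Aa; have [A0'|//] := CP _ CA; rewrite A0' in Aa.
  case: A0n => a0 A0a0; have [tA0 TA0 _] := CE _ _ CA0 A0a0.
  right; split; last by move=> a [A CA Aa]; case: (CE _ _ CA Aa) => _ _; apply.
    split=> [a /tA0.1 ?|a b [A CA Aa] [B CB Bab]]; first by exists A0.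
    have [tA _ _] := CE _ _ CA Aa; have [tB _ _] := CE _ _ CB Bab.
    have [AB|BA] := Ctot _ _ CA CB.
      by exists B => //; apply: mp Bab (AB _ Aa).
    by exists A => //; apply: mp (BA _ Bab) Aa.
  by move=> a /TA0 ?; exists A0.
have [tF TF FI] : [/\ theory F, T `<=` F & forall a, F a -> ~ I a].
  case: PF => // F0; exfalso; apply: (maxF T); last by right; split.
  rewrite F0; split; first by move=> x.
  by move=> /(_ _ (in_ftop tT)).
have avoid a : ~ F a -> exists2 i, I i & F (a ⊃ i).
  move=> nFa; apply: contrapT => nex.
  apply: (maxF [set b | F (a ⊃ b)]).
    split; first by move=> b /(in_const tF a).
    by move=> /(_ _ (in_id tF a)).
  right; split; first exact: theory_adjoin.
    by move=> b /TF /(in_const tF a).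
  by move=> b Fab Ib; apply: nex; exists b.
exists F; split=> //; split=> // [a b Fab|Fbot]; last first.
  by apply: (FI i0) => //; apply: mp (in_exfalso i0 tF) Fbot.
apply: contrapT => /not_orP [/avoid[i Ii Fai] /avoid[j Ij Fbj]].
have [c [Ic /(thm_in tF) ic /(thm_in tF) jc]] := dirI _ _ Ii Ij.
apply: (FI c) => //; apply: mp Fab => //; apply: in_or_elim => //.
  exact: in_trans ic.
exact: in_trans jc.
Qed.

(** Abstracts the set of formulas of value 1 at a state; [G (a ⊃ b)] is then the linear preorder of
    the values at that state. *)
Definition world (G : set fml) : Prop :=
  [/\ prime_theory G, forall a, G a -> G (△ a)
    & forall a, ~ G a -> G (∼ △ a)].

Section InWorld.
Variables (G : set fml) (wG : world G).

Lemma world_theory : theory G.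
Proof. by case: wG => -[]. Qed.
Let tG := world_theory.

Lemma world_bot : ~ G fbot.
Proof. by case: wG => -[]. Qed.

Lemma world_or a b : G (a ⊔ b) -> G a \/ G b.
Proof. by case: wG => -[_ +] _ _ _; apply. Qed.

Lemma world_total a b : G (a ⊃ b) \/ G (b ⊃ a).
Proof. by apply: world_or; apply: in_prelin. Qed.

Lemma world_imp a b : G (a ⊃ b) \/ G ((a ⊃ b) ⊃ b).
Proof. by apply: world_or; apply: in_imp_or. Qed.

Lemma world_neg a : G (a ⊃ fbot) -> G (∼ a).
Proof. exact: in_neg_intro. Qed.

Lemma world_nneg a : ~ G (a ⊃ fbot) -> G (∼ a ⊃ fbot).
Proof.
by case: (world_imp a fbot) => // /(in_trans tG (in_neg_elim tG a fbot)).
Qed.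

Lemma world_tri a : G a -> G (△ a).
Proof. by case: wG => _ + _; apply. Qed.

Lemma world_ntri a : ~ G a -> G (△ a ⊃ fbot).
Proof.
by case: wG => _ _ /[apply]; apply: mp => //; apply: in_neg_elim.
Qed.

End InWorld.

(** [△] distributes over [⊔], which makes the set prime; applied to the necessitation of
    [△ a ⊔ ∼ △ a], this also puts [△ ∼ △ a] in [F] whenever [△ a] is not. *)
Lemma world_of_prime (F : set fml) :
  prime_theory F -> world [set a | F (△ a)].
Proof.
case=> tF primeF F0.
have T a : F (△ a) -> F a.
  by apply: mp => //; apply: (HG_in tF [:: a] (ax_tri_T (PVar 0))).
have tri_or a b : F (△ (a ⊔ b)) -> F (△ a) \/ F (△ b).
  move=> Fab; apply: primeF; apply: mp Fab => //.
  exact: (HG_in tF [:: a; b] (ax_tri_or (PVar 0) (PVar 1))).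
split=> [|a|a].
- split=> [|//|/T//]; split=> [a da|a b /= Fa Fab].
    by apply: (thm_in tF); apply: der_tri.
  apply: (mp tF _ Fa); apply: (mp tF _ Fab).
  exact: (HG_in tF [:: a; b] (ax_tri_K (PVar 0) (PVar 1))).
- move=> Fa; apply: (mp tF _ Fa).
  exact: (HG_in tF [:: a] (ax_tri_4 (PVar 0))).
- move=> nFa; have [|/T/nFa|] // := tri_or (△ a) (∼ △ a).
    apply: (thm_in tF); apply: der_tri.
    exact: (derives_HG [:: a] (ax_tri_em (PVar 0))).
Qed.

(** * Chains of truth values *)

Section Modal.
Variables (T : set fml) (tT : theory T).

Lemma in_box a : derives set0 a -> T (□ a).
Proof. by move=> da; apply/(thm_in tT)/der_box. Qed.

Lemma in_box_K a b : T (□ (a ⊃ b) ⊃ □ a ⊃ □ b).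
Proof. exact/(thm_in tT)/der_ax/ax_box_K. Qed.

Lemma in_dia_bot : T (◇ fbot ⊃ fbot).
Proof.
apply: (mp tT (in_neg_elim tT _ _)); exact/(thm_in tT)/der_ax/ax_dia_bot.
Qed.

Lemma in_dia_or a b : T (◇ (a ⊔ b) ⊃ ◇ a ⊔ ◇ b).
Proof. exact/(thm_in tT)/der_ax/ax_dia_or. Qed.

Lemma in_FS1 a b : T (◇ (a ⊃ b) ⊃ □ a ⊃ ◇ b).
Proof. exact/(thm_in tT)/der_ax/ax_FS1. Qed.

Lemma in_FS2 a b : T ((◇ a ⊃ □ b) ⊃ □ (a ⊃ b)).
Proof. exact/(thm_in tT)/der_ax/ax_FS2. Qed.

Lemma in_dia_mp a b : T (◇ a ⊃ □ (a ⊃ b) ⊃ ◇ b).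
Proof.
apply: (in_trans tT) (in_FS1 _ _); apply: (thm_in tT); apply: der_dia.
have t0 := theory_derives set0.
apply: imp_intro => // U tU _ Ua; apply: imp_intro => // V tV UV Vab.
exact: (mp tV Vab (UV _ Ua)).
Qed.

End Modal.

(* Points of the chain of truth values of a tree of states numbered by [nat]:
   [(k, Some a)] is the value of [a] at [k], and [(k, None)] the degree to
   which [k] is accessible from its parent. *)
Definition chain_point : Type := (nat * option fml)%type.
Definition value (k : nat) (a : fml) : chain_point := (k, Some a).
Definition edge (k : nat) : chain_point := (k, None).

Definition truth (le : chain_point -> chain_point -> Prop) (k : nat) : set fml :=
  [set a | le (value k ftop) (value k a)].

(** [chain_box] and [chain_dia] are the easy halves of the modal clauses: [□ a] is at most the Gödel
    implication from the edge to [a], and the minimum of the edge and [a] is at most [◇ a]. *)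
Record chain (par : nat -> nat) (le : chain_point -> chain_point -> Prop) :
    Prop := Chain {
  chain_total : forall x y, le x y \/ le y x;
  chain_trans : forall y x z, le x y -> le y z -> le x z;
  chain_top : forall k x, le x (value k ftop);
  chain_bot : forall k x, le (value k fbot) x;
  chain_world : forall k, world (truth le k);
  chain_imp : forall k a b, le (value k a) (value k b) <-> truth le k (a ⊃ b);
  chain_box : forall k a, (0 < k)%N ->
    le (edge k) (value k a) \/ le (value (par k) (□ a)) (value k a);
  chain_dia : forall k a, (0 < k)%N ->
    le (edge k) (value (par k) (◇ a)) \/ le (value k a) (value (par k) (◇ a))
}.

(** States not grown yet already own points; a bottom edge makes them satisfy the modal clauses. The
    root has no parent, and [edge 0] is kept for the point separating the initial prime theory from
    its complement. *)
Definition unused_from (n : nat) (le : chain_point -> chain_point -> Prop) : Prop :=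
  forall k x, (n <= k)%N -> (0 < k)%N -> le (edge k) x.

Section ChainTheory.
Variables (par : nat -> nat) (le : chain_point -> chain_point -> Prop).
Hypothesis C : chain par le.

Lemma chain_refl x : le x x.
Proof. by case: (chain_total C x x). Qed.

Lemma chain_nle x y : ~ le x y -> le y x.
Proof. by case: (chain_total C x y). Qed.

Lemma truth_theory k : theory (truth le k).
Proof. exact: world_theory (chain_world C k). Qed.

Lemma chain_le k a b : truth le k (a ⊃ b) -> le (value k a) (value k b).
Proof. exact: (chain_imp C k a b).2. Qed.

Lemma truth_le k x a : truth le k a -> le x (value k a).
Proof. exact: (chain_trans C (chain_top C k x)). Qed.

Lemma chain_imp_or k a b :
  truth le k (a ⊃ b) \/ le (value k (a ⊃ b)) (value k b).
Proof.
by have [|/chain_le] := world_imp (chain_world C k) a b; [left | right].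
Qed.

Lemma chain_residual k a b c :
  truth le k (a ⊃ b ⊃ c) -> ~ le (value k b) (value k c) ->
  le (value k a) (value k c).
Proof.
move=> /chain_le abc nbc; have [/chain_le //|] := chain_imp_or k b c.
exact: (chain_trans C).
Qed.

End ChainTheory.

(** * Adding one state to a chain around a cut *)

Section Extension.
Variables (par : nat -> nat) (le : chain_point -> chain_point -> Prop) (n : nat).
Hypotheses (C : chain par le) (n0 : (0 < n)%N).
Hypothesis par_lt : forall k, (0 < k)%N -> (par k < k)%N.
Hypothesis unused : unused_from n le.
(** [Lw] is the lower part of the cut, and [F] collects the formulas whose new value is to lie above
    the new edge. *)
Variables (F : set fml) (Lw : set chain_point).
Let p := par n.
Hypotheses (F_prime : prime_theory F)
  (Lw_down : forall x y, le x y -> Lw y -> Lw x)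
  (Lw_bot : Lw (value p fbot)) (Lw_top : ~ Lw (value p ftop))
  (F_box : forall a, ~ Lw (value p (□ a)) -> F a)
  (F_dia : forall a, F a -> ~ Lw (value p (◇ a))).
Let G : set fml := [set a | F (△ a)].

Let tF : theory F.
Proof. by case: F_prime. Qed.
Let wG : world G.
Proof. exact: world_of_prime. Qed.
Let tG : theory G.
Proof. exact: world_theory. Qed.
Let GF a : G a -> F a.
Proof. exact: (mp tF (HG_in tF [:: a] (ax_tri_T (PVar 0)))). Qed.
Let F_bot : ~ F fbot. Proof. by case: F_prime. Qed.

(** A Gödel implication has value 1 or that of its conclusion: were [(a ⊃ b) ⊃ b] in [G], [b] would
    be in [F]. *)
Let F_imp a b : F (a ⊃ b) -> ~ F b -> G (a ⊃ b).
Proof.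
move=> Fab nFb; have [//|/GF Fabb] := world_imp wG a b.
by case: nFb; apply: (mp tF Fabb).
Qed.

(* A point of the new chain: an old point, a value at the new state, or the
   degree of accessibility of the new state. *)
Let view (x : chain_point) : chain_point + option fml :=
  if x.1 != n then inl x else inr x.2.

(* From bottom to top: the old points in [Lw] mixed with the new values outside
   [F], the degree of accessibility, the new values in [F], the old points
   outside [Lw]; the old and new points of value 1 are identified on top. *)
Let lev (v : chain_point + option fml) : nat :=
  match v with
  | inl x => if `[< Lw x >] then 0
             else if `[< le (value p ftop) x >] then 4 else 3
  | inr None => 1
  | inr (Some a) => if `[< G a >] then 4 else if `[< F a >] then 2 else 0
  end.

(* [below x a] puts [x] below the new value of [a], and [above a x] above it; a
   pair on which neither is forced is resolved by putting the new value below. *)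
Let below x a := exists b, le x (value p (□ b)) /\ G (b ⊃ a).
Let above a x := exists b, G (a ⊃ b) /\ le (value p (◇ b)) x.

Let loc (v w : chain_point + option fml) : Prop :=
  match v, w with
  | inl x, inl y => le x y
  | inl x, inr (Some b) => below x b
  | inr (Some a), inl y => ~ below y a \/ above a y
  | inr (Some a), inr (Some b) => G (a ⊃ b)
  | inr None, inr None => True
  | _, _ => False
  end.

(** Levels come first, then [loc]. Old and new points share only the levels 0 and 4, and level 4 is
    a single class. *)
Let leq' v w : Prop := (lev v < lev w)%N \/
  lev v = lev w /\ (lev v = 4 \/ loc v w).

Let levP x a : lev (inl x) = lev (inr (Some a)) -> lev (inl x) <> 4 ->
  Lw x /\ ~ F a.
Proof.
by rewrite /lev; do ?[case: asboolP => ?].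
Qed.

Let levF a : ~ F a -> lev (inr (Some a)) = 0.
Proof.
by rewrite /= => nFa; case: asboolP => [/GF//|_]; case: asboolP.
Qed.

Let lev0x x : Lw x -> lev (inl x) = 0.
Proof. by rewrite /=; case: asboolP. Qed.

(** If [x] were strictly above [y], then [□ a] would be strictly above [◇ b], so [◇ (a ⊃ b)] would
    be at most [◇ b] by [in_FS1], hence in [Lw], against [F_dia]. *)
Let squeeze a b x y : G (a ⊃ b) -> le x (value p (□ a)) ->
  le (value p (◇ b)) y -> Lw y -> le x y.
Proof.
move=> Gab xa by_ Ly; apply: contrapT => nxy.
have nab : ~ le (value p (□ a)) (value p (◇ b)).
  by move=> ab; apply: nxy; apply: (chain_trans C) (chain_trans C xa ab) by_.
case: (F_dia (GF Gab)); apply: Lw_down Ly; apply: (chain_trans C) by_.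
exact: (chain_residual C) (in_FS1 (truth_theory C p) _ _) nab.
Qed.

(** As [◇ c] is below [□ d], [in_FS2] makes [□ (c ⊃ d)] true, hence outside [Lw]; so [c ⊃ d] is in
    [F], and [F_imp] lifts the result to [G]. *)
Let interleave a b x : ~ F b -> above a x -> below x b -> G (a ⊃ b).
Proof.
move=> nFb [c [Gac cx]] [d [xd Gdb]]; apply: F_imp nFb.
apply: (in_trans tF) (GF Gdb); apply: (in_trans tF) (GF Gac) _.
apply: F_box => Lcd; apply: Lw_top; apply: Lw_down Lcd.
apply: (chain_le C); apply: (in_const (truth_theory C p)).
apply: (mp (truth_theory C p)) (in_FS2 (truth_theory C p) _ _) _.
exact: (chain_imp C _ _ _).1 (chain_trans C cx xd).
Qed.

Let leq'_total v w : leq' v w \/ leq' w v.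
Proof.
rewrite /leq'; have [?|?|e] := ltngtP (lev v) (lev w); [by left; left|by right; left|].
have [?|n4] := eqVneq (lev v) 4; first by left; right; split=> //; left.
suff [] : loc v w \/ loc w v.
- by left; right; split=> //; right.
- by right; right; split=> //; right.
case: v w e {n4} => [x|[a|]] [y|[b|]] //=.
- by move=> _; apply: (chain_total C).
- by move=> _; have [|] := pselect (below x b); [left|right; left].
- by case: asboolP => //; case: asboolP.
- by move=> _; have [|] := pselect (below y a); [right|left; left].
- by move=> _; apply: world_total.
- by case: asboolP => //; case: asboolP.
- by case: asboolP => //; case: asboolP.
- by case: asboolP => //; case: asboolP.
- by left.
Qed.

Let leq'_trans v w u : leq' v w -> leq' w u -> leq' v u.
Proof.
rewrite /leq' => -[vw|[vw]]; first by move=> [wu|[wu _]]; left; lia.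
move=> h [wu|[wu h']]; first by left; lia.
right; split; first by rewrite vw.
have [|n4] := eqVneq (lev v) 4; first by left.
right; have {}h : loc v w by case: h => // e; rewrite e in n4.
have {}h' : loc w u by case: h' => // e; rewrite vw e in n4.
(* The patterns old-new-old and new-old-new rest on [squeeze] and [interleave]; the others only
   compose [le] or [G]. *)
case: v w u vw wu n4 h h' => [x|[a|]] [y|[b|]] [z|[c|]] // vw wu n4.
- exact: (chain_trans C).
- by move=> xy [d [yd dc]]; exists d; split=> //; apply: (chain_trans C) yd.
- move=> [d [xd db]] [nz|[d' [bd' d'z]]].
    apply: (chain_nle C) => zx; apply: nz; exists d; split=> //.
    exact: (chain_trans C) xd.
  apply: (squeeze (a := d) (b := d')) => //; first exact: (in_trans tG) bd'.
  by case: (levP (esym wu)) => //; rewrite -wu -vw; apply/eqP.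
- by move=> [d [xd db]] bc; exists d; split=> //; apply: (in_trans tG) bc.
- move=> [nya|[d [ad dy]]] yz.
    by left=> -[d [zd da]]; apply: nya; exists d; split=> //; apply: (chain_trans C) zd.
  by right; exists d; split=> //; apply: (chain_trans C) yz.
- move=> [nya|ay] yc.
    have [//|ca] := world_total wG a c.
    case: nya; case: yc => d [yd dc]; exists d; split=> //.
    exact: (in_trans tG) ca.
  by apply: interleave ay yc; case: (levP wu) => //; rewrite -vw; apply/eqP.
- move=> ab [nzb|[d [bd dz]]].
    left=> -[d [zd da]]; apply: nzb; exists d; split=> //.
    exact: (in_trans tG) ab.
  by right; exists d; split=> //; apply: (in_trans tG) bd.
- exact: (in_trans tG).
Qed.

Let lev_mono a b : G (a ⊃ b) -> (lev (inr (Some a)) <= lev (inr (Some b)))%N.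
Proof.
move=> Gab /=; case: (asboolP (G b)) => [_|nGb].
  by case: asboolP => //; case: asboolP.
case: asboolP => [Ga|_]; first by case: nGb; apply: (mp tG) Ga.
case: (asboolP (F b)) => [_|nFb]; first by case: asboolP.
by case: asboolP => // Fa; case: nFb; apply: (mp tF) (GF Gab) Fa.
Qed.

Let lev_old_mono x y : le x y -> (lev (inl x) <= lev (inl y))%N.
Proof.
move=> xy /=; case: (asboolP (Lw x)) => [//|nLx].
case: (asboolP (Lw y)) => [/(Lw_down xy)//|_].
case: asboolP => [tx|_]; last by case: asboolP.
by case: asboolP => // nty; case: nty; apply: (chain_trans C) tx xy.
Qed.

Let lev_top v w : lev w = 4 -> leq' v w.
Proof.
move=> w4; have : (lev v <= lev w)%N.
  by rewrite w4; case: v => [x|[a|]] //; rewrite /lev; do ?[case: asboolP => ?].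
by rewrite leq_eqVlt => /orP[/eqP e|?]; [right; split=> //; left; rewrite e | left].
Qed.

Let leq'_old x y : leq' (inl x) (inl y) <-> le x y.
Proof.
split=> [[lt|[e [x4|//]]]|xy].
- by apply: (chain_nle C) => /lev_old_mono; lia.
- apply: (chain_trans C (chain_top C p x)); move: x4; rewrite e /=.
  by do ?[case: asboolP => ?].
- by have := lev_old_mono xy; rewrite leq_eqVlt => /orP[/eqP e|?];
    [right; split=> //; right | left].
Qed.

Let leq'_new a b : leq' (inr (Some a)) (inr (Some b)) <-> G (a ⊃ b).
Proof.
split=> [[lt|[e [a4|//]]]|ab].
- by case: (world_total wG a b) => // /lev_mono; lia.
- apply: (in_const tG); move: a4; rewrite e /=.
  by do ?[case: asboolP => ?].
- by have := lev_mono ab; rewrite leq_eqVlt => /orP[/eqP e|?];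
    [right; split=> //; right | left].
Qed.

Let ext x y := leq' (view x) (view y).

Let view_old x : x.1 != n -> view x = inl x.
Proof. by rewrite /view => ->. Qed.

Let view_value a : view (value n a) = inr (Some a).
Proof. by rewrite /view eqxx. Qed.

Let view_edge : view (edge n) = inr None.
Proof. by rewrite /view eqxx. Qed.

Let ext_old x y : x.1 != n -> y.1 != n -> ext x y <-> le x y.
Proof. by move=> xn yn; rewrite /ext !view_old //; apply: leq'_old. Qed.

Let ext_new a b : ext (value n a) (value n b) <-> G (a ⊃ b).
Proof. by rewrite /ext !view_value; apply: leq'_new. Qed.

Let ext_truth_old k : k != n -> truth ext k = truth le k.
Proof. by move=> kn; apply/seteqP; split=> a /=; apply ext_old. Qed.

Let ext_truth_new : truth ext n = G.
Proof.
apply/seteqP; split=> a; first by move/ext_new => /(mp tG); apply; apply: in_ftop.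
by move=> Ga; apply/ext_new/(in_const tG).
Qed.

Let lev_F a : F a -> (1 < lev (inr (Some a)))%N.
Proof. by move=> Fa /=; do ?[case: asboolP => ?]. Qed.

Let lev_nLw x : ~ Lw x -> (2 < lev (inl x))%N.
Proof. by move=> ? /=; do ?[case: asboolP => ?]. Qed.

Let ext_bot k x : ext (value k fbot) x.
Proof.
rewrite /ext; have [->|kn] := eqVneq k n.
  rewrite view_value; case: (view x) => [y|[a|]].
  - have [Ly|/lev_nLw Ly] := pselect (Lw y); last by left; rewrite levF //; lia.
    right; split; first by rewrite levF ?lev0x.
    right; right; exists fbot; split; first exact: in_id.
    apply: (chain_trans C _ (chain_bot C p y)); apply: (chain_le C).
    exact: (in_dia_bot (truth_theory C p)).
  - by apply/leq'_new; apply: in_exfalso.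
  - by left; rewrite levF.
have Lk : Lw (value k fbot) by apply: Lw_down Lw_bot; apply: (chain_bot C).
rewrite (view_old (x := value k fbot)) //; case: (view x) => [y|[a|]].
- by apply/leq'_old; apply: (chain_bot C).
- have [/lev_F Fa|nFa] := pselect (F a); first by left; rewrite lev0x //; lia.
  right; split; first by rewrite levF ?lev0x.
  right; exists fbot; split; first exact: (chain_bot C).
  exact: in_exfalso.
- by left; rewrite lev0x.
Qed.

Let ext_unused : unused_from n.+1 ext.
Proof.
move=> k x nk k0; apply: leq'_trans (ext_bot 0 x).
apply/ext_old; rewrite /= ?[_ != n]neq_ltn ?n0 ?nk ?orbT //.
by apply: unused => //; apply: ltnW.
Qed.

Let ext_chain : chain par ext.
Proof.
have par_neq k : (0 < k < n)%N -> par k != n.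
  by case/andP=> k0 kn; rewrite neq_ltn (ltn_trans (par_lt k0) kn).
split=> [x y|x y z|k x|k x|k|k a b|k a k0|k a k0].
- exact: leq'_total.
- exact: leq'_trans.
- rewrite /ext; have [->|kn] := eqVneq k n; last first.
    rewrite (view_old (x := value k ftop)) //; apply: lev_top => /=.
    case: asboolP => [Lk|_].
      by case: Lw_top; apply: Lw_down Lk; apply: (chain_top C).
    by case: asboolP => // -[]; apply: (chain_top C).
  rewrite view_value; apply: lev_top => /=.
  by case: asboolP => // -[]; apply: in_ftop.
- exact: ext_bot.
- have [->|kn] := eqVneq k n; first by rewrite ext_truth_new.
  by rewrite ext_truth_old //; apply: (chain_world C).
- have [->|kn] := eqVneq k n; first by rewrite ext_truth_new; apply: ext_new.
  by rewrite ext_truth_old // -(chain_imp C); apply: ext_old.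
(* For [k = n], either [a] is in [F], above the edge, or [□ a] is in [Lw], and then [a] itself
   witnesses [below]. For [k > n] the parent may be [n], and the bottom edge settles the case. *)
- have [kn|nk|->] := ltngtP k n; last 1 first.
  + have [Fa|nFa] := pselect (F a).
      by left; rewrite /ext view_edge view_value; left; apply: lev_F.
    right; rewrite /ext view_value view_old ?neq_ltn ?par_lt //.
    have La : Lw (value p (□ a)) by apply: contrapT => /F_box.
    right; split; first by rewrite levF ?lev0x.
    right; exists a; split; [exact: (chain_refl C) | exact: in_id].
  + have kn' : k != n by rewrite neq_ltn kn.
    have pn : par k != n by rewrite par_neq ?k0.
    by case: (chain_box C a k0) => h; [left|right]; apply/ext_old.
  + by left; apply: ext_unused.
- have [kn|nk|->] := ltngtP k n; last 1 first.
  + have [La|nLa] := pselect (Lw (value p (◇ a))); last first.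
      left; rewrite /ext view_edge view_old ?neq_ltn ?par_lt //.
      by left; apply: ltn_trans (lev_nLw nLa).
    have nFa : ~ F a by move/F_dia.
    right; rewrite /ext view_value view_old ?neq_ltn ?par_lt //.
    right; split; first by rewrite levF ?lev0x.
    by right; right; exists a; split; [apply: in_id | apply: (chain_refl C)].
  + have kn' : k != n by rewrite neq_ltn kn.
    have pn : par k != n by rewrite par_neq ?k0.
    by case: (chain_dia C a k0) => h; [left|right]; apply/ext_old.
  + by left; apply: ext_unused.
Qed.

Lemma chain_extension : exists le', [/\ chain par le', unused_from n.+1 le',
  forall x y, x.1 != n -> y.1 != n -> le' x y <-> le x y,
  forall a, ~ F a -> ~ le' (edge n) (value n a) /\
    forall x, x.1 != n -> ~ Lw x -> ~ le' x (value n a)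
  & forall a x, F a -> x.1 != n -> Lw x ->
    ~ le' (edge n) x /\ ~ le' (value n a) x].
Proof.
have nleq' v w : (lev w < lev v)%N -> ~ leq' v w.
  by move=> wv [|[]]; lia.
exists ext; split=> // [a nFa|a x Fa xn Lx].
  split=> [|x xn nLx]; rewrite /ext view_value.
    by rewrite view_edge; apply: nleq'; rewrite levF.
  by rewrite view_old //; apply: nleq'; rewrite levF //; apply: ltn_trans (lev_nLw nLx).
rewrite /ext view_value view_edge view_old //; split; apply: nleq'.
  by rewrite lev0x.
by rewrite lev0x //; apply: ltn_trans (lev_F Fa).
Qed.

End Extension.

(** * Growing the tree of states *)

(* The new state [n] witnesses the value of a modal formula at its parent, up
   to the points already present. *)
Definition witness (par : nat -> nat) (n : nat) (c : fml)
    (le : chain_point -> chain_point -> Prop) : Prop :=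
  match c with
  | Box a => truth le (par n) (□ a) \/
      ~ le (edge n) (value n a) /\
      forall x, (x.1 < n)%N -> ~ le x (value (par n) (□ a)) -> ~ le x (value n a)
  | Dia a => le (value (par n) (◇ a)) (value (par n) fbot) \/
      forall x, (x.1 < n)%N -> ~ le (value (par n) (◇ a)) x ->
        ~ le (edge n) x /\ ~ le (value n a) x
  | _ => True
  end.

Section Step.
Variables (par : nat -> nat).
Hypothesis par_lt : forall k, (0 < k)%N -> (par k < k)%N.

(** Cut just above [□ a]. The formulas [b] with [□ b] strictly above [□ a] form a theory without
    [a], so a prime theory extends it and still omits [a]. *)
Lemma box_witness le n a : chain par le -> (0 < n)%N -> unused_from n le ->
  exists le', [/\ chain par le', unused_from n.+1 le',
    forall x y, x.1 != n -> y.1 != n -> le' x y <-> le x y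
    & witness par n (□ a) le'].
Proof.
move=> C n0 un; set p := par n.
have tp := truth_theory C p.
have pn : p != n by rewrite neq_ltn par_lt.
have [ta|nta] := pselect (truth le p (□ a)).
  exists le; split=> //; last by left.
  by move=> k x nk; apply: un; apply: ltnW.
pose T := [set b | ~ le (value p (□ b)) (value p (□ a))].
have tT : theory T.
  split=> [b db bx|b c Tb Tbc bx].
    apply: nta; apply: (chain_trans C) bx; apply: (truth_le C).
    exact: in_box.
  apply: Tbc; apply: (chain_trans C) (bx).
  apply: (chain_residual C) (in_box_K tp _ _) _ => bc.
  exact: Tb (chain_trans C bc bx).
have [|||F [pF TF FI]] := @prime_extension T [set a] tT.
- by move=> b Tb /= ba; apply: Tb; rewrite ba; apply: (chain_refl C).
- by exists a.
- move=> b c /= -> ->; exists a; split=> //; exact: (in_id (theory_derives set0)).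
have nFa : ~ F a by move/FI; apply.
have tF : theory F by case: pF.
have [|||||le' [C' un' old new _]] :=
  chain_extension C n0 par_lt un pF (Lw := [set x | le x (value p (□ a))]).
- by move=> x y xy; apply: (chain_trans C).
- exact: (chain_bot C).
- exact: nta.
- by move=> b /TF.
(* If [◇ b] were at most [□ a], [in_FS2] would make [□ (b ⊃ a)] true, putting [b ⊃ a] in [T] and [a]
   in [F]. *)
- move=> b Fb /= ba; apply: nFa; apply: (mp tF) Fb; apply: TF => /= baa.
  apply: nta; apply: (chain_trans C) baa; apply: (mp tp (in_FS2 tp _ _)).
  exact: ((chain_imp C _ _ _).1 ba).
- exists le'; split=> //; right; have [nea H] := new _ nFa.
  split=> // x xn nx; apply: H; first by rewrite neq_ltn xn.
  by move=> /= xa; apply: nx; apply/old; rewrite //= neq_ltn xn.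
Qed.

(** Cut just below [◇ a]. The prime theory contains [a] and every [b] with [◇ a] at most [□ b], and
    avoids the [b] with [◇ b] strictly below [◇ a]; [in_dia_mp] makes the two sides disjoint, and
    [in_dia_or] makes the avoided set directed. *)
Lemma dia_witness le n a : chain par le -> (0 < n)%N -> unused_from n le ->
  exists le', [/\ chain par le', unused_from n.+1 le',
    forall x y, x.1 != n -> y.1 != n -> le' x y <-> le x y
    & witness par n (◇ a) le'].
Proof.
move=> C n0 un; set p := par n.
have tp := truth_theory C p.
have pn : p != n by rewrite neq_ltn par_lt.
have [ba|nba] := pselect (le (value p (◇ a)) (value p fbot)).
  exists le; split=> //; last by left.
  by move=> k x nk; apply: un; apply: ltnW.
have t0 := theory_derives set0.
pose B := [set b | le (value p (◇ a)) (value p (□ b))].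
have tB : theory B.
  split=> [b db|b c Bb Bbc] /=; first by apply: (truth_le C); apply: in_box.
  apply: contrapT => nac; case: (nac); apply: (chain_trans C Bbc).
  apply: (chain_residual C) (in_box_K tp _ _) _ => bc.
  by apply: nac; apply: (chain_trans C Bb).
pose I := [set b | ~ le (value p (◇ a)) (value p (◇ b))].
have [|||F [pF TF FI]] := @prime_extension _ I (theory_adjoin tB a).
- move=> b /= Bab; apply.
  have [|nab] := pselect (le (value p (□ (a ⊃ b))) (value p (◇ b))).
    exact: (chain_trans C Bab).
  exact: (chain_residual C (in_dia_mp tp _ _) nab).
- exists fbot => /= a0; apply: nba; apply: (chain_trans C a0).
  exact: (chain_le C (in_dia_bot tp)).
- move=> b c Ib Ic; exists (b ⊔ c); split; [|exact: in_orl|exact: in_orr].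
  move=> /= abc; have h := chain_trans C abc (chain_le C (in_dia_or tp b c)).
  have [bc|cb] := world_total (chain_world C p) (◇ b) (◇ c).
    case: Ic; apply: (chain_trans C h); apply: (chain_le C).
    by apply: in_or_elim => //; apply: in_id.
  case: Ib; apply: (chain_trans C h); apply: (chain_le C).
  by apply: in_or_elim => //; apply: in_id.
have tF : theory F by case: pF.
have Fa : F a by apply: TF; apply: in_id.
have [|||||le' [C' un' old _ new]] :=
  chain_extension C n0 par_lt un pF (Lw := [set x | ~ le (value p (◇ a)) x]).
- by move=> x y xy /= nay ax; apply: nay; apply: (chain_trans C) xy.
- exact: nba.
- by apply; apply: (chain_top C).
- move=> b /= /contrapT ab; apply: TF; apply: (in_const tB); exact: ab.
- by move=> b /FI.
- exists le'; split=> //; right=> x xn nax; apply: new => //=.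
    by rewrite neq_ltn xn.
  by move=> ax; apply: nax; apply/old; rewrite //= neq_ltn xn.
Qed.

Lemma witness_step le n c : chain par le -> (0 < n)%N -> unused_from n le ->
  exists le', [/\ chain par le', unused_from n.+1 le',
    forall x y, x.1 != n -> y.1 != n -> le' x y <-> le x y
    & witness par n c le'].
Proof.
move=> C n0 un; case: c => [k|a|a|a b|a b|a b|a|a]; last 2 first.
- exact: box_witness.
- exact: dia_witness.
all: by exists le; split=> // j x nj; apply: un; apply: ltnW.
Qed.

End Step.

Section Root.
Variable F : set fml.
Hypothesis F_prime : prime_theory F.
Let G : set fml := [set a | F (△ a)].

(** All states start as copies of the world [G], with edges at the bottom; only [edge 0] is a point
    of its own, between [F] and its complement. *)
Let root_view (x : chain_point) : option fml :=
  if x.2 is Some a then Some a else if x.1 == 0%N then None else Some fbot.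

Let root_le (v w : option fml) : Prop :=
  match v, w with
  | Some a, Some b => G (a ⊃ b)
  | Some a, None => ~ F a
  | None, Some b => F b
  | None, None => True
  end.

Lemma root_chain par : exists le, [/\ chain par le, unused_from 1 le
  & forall a, le (edge 0) (value 0 a) <-> F a].
Proof.
have tF : theory F by case: F_prime.
have wG : world G by exact: world_of_prime.
have tG := world_theory wG.
have GF a b : G (a ⊃ b) -> F a -> F b.
  move=> Gab; apply: (mp tF); apply: (mp tF) Gab.
  exact: (HG_in tF [:: a ⊃ b] (ax_tri_T (PVar 0))).
have F_bot : ~ F fbot by case: F_prime.
have total v w : root_le v w \/ root_le w v.
  case: v w => [a|] [b|] /=; last by left.
  - exact: world_total.
  - by have [|] := pselect (F a); [right|left].
  - by have [|] := pselect (F b); [left|right].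
have trans w v u : root_le v w -> root_le w u -> root_le v u.
  case: v w u => [a|] [b|] [c|] //=.
  - exact: in_trans.
  - by move=> ab nb /(GF _ _ ab).
  - by move=> na Fc; case: (world_total wG a c) => // /GF /(_ Fc).
  - by move=> Fb /GF; apply.
have wE k : truth (fun x y => root_le (root_view x) (root_view y)) k = G.
  apply/seteqP; split=> a /=; last exact: in_const.
  by move/(mp tG); apply; apply: in_ftop.
exists (fun x y => root_le (root_view x) (root_view y)); split=> //; last first.
  by move=> [|k] [j [a|]] //= _ _; rewrite /root_view /=;
    [|case: eqP => //= _]; apply: in_exfalso.
split=> [x y|x y z|k x|k x|k|k a b|k a k0|k a k0]; rewrite ?wE //.
- exact: trans.
- rewrite /root_view; case: x => j [a|] /=.
    by apply: (in_const tG); apply: in_ftop.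
  by case: eqP => _ /=; [apply: in_ftop | apply: in_exfalso].
- rewrite /root_view; case: x => j [a|] /=; first exact: in_exfalso.
  by case: eqP => _ //=; apply: in_exfalso.
- by left; rewrite /root_view /= -[_ == _]negbK -lt0n k0 /=; apply: in_exfalso.
- by left; rewrite /root_view /= -[_ == _]negbK -lt0n k0 /=; apply: in_exfalso.
Qed.

End Root.

Section Limit.
Variables (par : nat -> nat) (task : nat -> fml).
Hypothesis par_lt : forall k, (0 < k)%N -> (par k < k)%N.

(** Stage [n] settles state [n] and keeps the order among the points of earlier states, so two
    points can be compared at the stage of the later one. *)
Lemma witnessed_chain (F : set fml) : prime_theory F ->
  exists le, [/\ chain par le, forall a, le (edge 0) (value 0 a) <-> F a
    & forall n, (0 < n)%N -> witness par n (task n) le].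
Proof.
move=> F_prime; have [le0 [C0 un0 root0]] := root_chain F_prime par.
pose ok n le := chain par le /\ unused_from n le.
have /choice[next nextP] : forall q : nat * (chain_point -> chain_point -> Prop), exists le',
    (0 < q.1)%N -> ok q.1 q.2 -> [/\ ok q.1.+1 le',
      forall x y, x.1 != q.1 -> y.1 != q.1 -> le' x y <-> q.2 x y
      & witness par q.1 (task q.1) le'].
  move=> [n le]; have [[n0 [C un]]|bad] := pselect ((0 < n)%N /\ ok n le).
    have [le' [C' un' old wit]] := witness_step par_lt (task n) C n0 un.
    by exists le'.
  by exists le => n0 Cn; case: bad.
pose S := fix S n := if n is m.+1 then next (n, S m) else le0.
have S_ok n : ok n.+1 (S n).
  by elim: n => [|n IH] //=; have [] := nextP (n.+1, S n) isT IH.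
have S_succ n x y : (x.1 <= n)%N -> (y.1 <= n)%N -> S n.+1 x y <-> S n x y.
  move=> xn yn; have [_ + _] := nextP (n.+1, S n) isT (S_ok n).
  by apply; rewrite neq_ltn ltnS ?xn ?yn.
have S_wit n : (0 < n)%N -> witness par n (task n) (S n).
  by case: n => // n _; have [] := nextP (n.+1, S n) isT (S_ok n).
pose le x y := S (maxn x.1 y.1) x y.
have leE n x y : (x.1 <= n)%N -> (y.1 <= n)%N -> le x y <-> S n x y.
  move=> xn yn; have : (maxn x.1 y.1 <= n)%N by rewrite geq_max xn.
  elim: n {xn yn} => [|n IH]; first by rewrite leqn0 /le => /eqP ->.
  rewrite leq_eqVlt => /orP[/eqP <- //|]; rewrite ltnS => h.
  rewrite IH // -S_succ //; apply: leq_trans h; rewrite leq_max leqnn ?orbT //.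
have truthE k : truth le k = truth (S k) k.
  by apply/seteqP; split=> a; apply leE.
exists le; split=> [|a|n n0]; last 1 first.
- have pn := par_lt n0; have := S_wit n n0.
  case: (task n) => //= a; rewrite /truth /= (leE n) ?(ltnW pn) //.
  + case=> [?|[h H]]; [by left|right; split; first by rewrite (leE n)].
    by move=> x xn; rewrite !(leE n) ?(ltnW pn) ?(ltnW xn) //; apply: H.
  + case=> [?|H]; [by left|right].
    by move=> x xn; rewrite !(leE n) ?(ltnW pn) ?(ltnW xn) //; apply: H.
- have C k := (S_ok k).1.
  split=> [x y|y x z|k x|k x|k|k a b|k a k0|k a k0].
  + rewrite !(leE (maxn x.1 y.1)) ?leq_max ?leqnn ?orbT //.
    exact: (chain_total (C _)).
  + pose n := maxn (maxn x.1 y.1) z.1.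
    rewrite !(leE n) ?leq_max ?leqnn ?orbT //; exact: (chain_trans (C _)).
  + exact: (chain_top (C _)).
  + exact: (chain_bot (C _)).
  + rewrite truthE; exact: (chain_world (C k)).
  + by rewrite truthE (leE k) //; apply: (chain_imp (C k)).
  + have pk := ltnW (par_lt k0).
    by rewrite !(leE k) //; apply: (chain_box (C k)).
  + have pk := ltnW (par_lt k0).
    by rewrite !(leE k) //; apply: (chain_dia (C k)).
- by rewrite (leE 0%N).
Qed.

End Limit.

(** * Midpoint embedding of a countable preorder *)

Local Open Scope ring_scope.

(** Values may repeat: the premises hold only when [e n] differs from all earlier values, and then
    [e i] and [e j] are its neighbours among them. *)
Definition midpoint_sequence (R : realType) (e : nat -> R) : Prop :=
  forall n i j, (i < n)%N -> (j < n)%N ->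
    (forall k, (k < n)%N -> e k <= e i \/ e j <= e k) ->
    e i < e n < e j -> e n = (e i + e j) / 2.

Lemma midpoint_sequence_opp (R : realType) (e : nat -> R) :
  midpoint_sequence e -> midpoint_sequence (fun n => - e n).
Proof.
move=> mid n i j ni nj gap; rewrite !ltrN2 andbC => h.
rewrite (mid n j i) //; first by field.
by move=> k /gap; rewrite !lerN2 => -[]; [right | left].
Qed.

(* As long as no value is least above [e i], the values just above [e i] are
   split in two infinitely often. *)
Lemma midpoint_right_limit (R : realType) (e : nat -> R) (i j : nat) (eps : R) :
  midpoint_sequence e -> e i < e j ->
  (forall k, e i < e k -> exists l, e i < e l < e k) -> 0 < eps ->
  exists k, e i < e k < e i + eps.
Proof.
move=> mid ij dense eps0.
(* Between [e i] and the least earlier value above it, the first later arrival takes the midpoint,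
   so the gap at least halves each time. *)
have halving m : exists2 k, e i < e k & (e k - e i) * 2 ^+ m <= e j - e i.
  elim: m => [|m [k ik km]]; first by exists j; rewrite // expr0 mulr1.
  pose N := (maxn i k).+1.
  have iN : (i < N)%N by rewrite ltnS leq_max leqnn.
  have kN : (k < N)%N by rewrite ltnS leq_max leqnn orbT.
  case: (@arg_minP _ _ _ (Ordinal kN) (fun l : 'I_N => e i < e l)
    (fun l : 'I_N => e l)) => //= q iq qmin.
  have gap l : (l < N)%N -> e l <= e i \/ e q <= e l.
    move=> lN; have [?|il] := leP (e l) (e i); [by left|right].
    exact: (qmin (Ordinal lN)).
  have /ex_minnP[n hn nmin] : exists l, e i < e l < e q by exact: dense.
  have Nn : (N <= n)%N.
    by rewrite leqNgt; apply/negP => /gap; move/andP: hn => []; lra.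
  have en : e n = (e i + e q) / 2.
    apply: mid hn; [exact: leq_trans Nn|exact: leq_trans Nn|move=> l ln].
    have [?|il] := leP (e l) (e i); [by left|right].
    rewrite leNgt; apply/negP => lq.
    by have := nmin l; rewrite il lq leqNgt ln => /(_ isT).
  exists n; first by case/andP: hn.
  apply: le_trans km; rewrite en exprS mulrA ler_wpM2r ?exprn_ge0 //.
  by have := qmin (Ordinal kN) ik; rewrite /=; lra.
pose D := (e j - e i) / eps.
have D0 : 0 <= D by apply: divr_ge0; rewrite ?subr_ge0; apply: ltW.
have [k ik km] := halving (Num.Def.archi_bound D).
exists k; rewrite ik /= -ltrBlDl.
have D2 : D < 2 ^+ Num.Def.archi_bound D.
  apply: lt_trans (archi_boundP D0) _.
  by rewrite -natrX ltr_nat ltn_expl.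
have P0 : 0 < 2 ^+ Num.Def.archi_bound D :> R by rewrite exprn_gt0.
rewrite -(ltr_pM2r P0); apply: le_lt_trans km _.
by rewrite -ltr_pdivrMl // mulrC.
Qed.

Section Embedding.
Variables (R : realType) (L : nat -> nat -> Prop).
Hypotheses (L_total : forall i j, L i j \/ L j i)
  (L_trans : forall j i k, L i j -> L j k -> L i k)
  (L_bot : forall i, L 0 i) (L_top : forall i, L i 1) (L10 : ~ L 1 0).

Definition lower (n : nat) (s : seq R) : R :=
  \big[Num.max/0]_(i < n | `[< L i n >]) s`_i.
Definition upper (n : nat) (s : seq R) : R :=
  \big[Num.min/1]_(i < n | `[< L n i >]) s`_i.

(* Points [0] and [1] are the bounds of the preorder; each other point is sent
   half way between its current neighbours. *)
Definition place (n : nat) (s : seq R) : R :=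
  if n is n'.+1 then if n' is n''.+1 then (lower n s + upper n s) / 2 else 1
  else 0.

Fixpoint places (n : nat) : seq R :=
  if n is m.+1 then rcons (places m) (place m (places m)) else [::].

Definition embed (n : nat) : R := place n (places n).

Lemma size_places n : size (places n) = n.
Proof. by elim: n => //= n IH; rewrite size_rcons IH. Qed.

Lemma nth_places n i : (i < n)%N -> (places n)`_i = embed i.
Proof.
elim: n => // n IH; rewrite ltnS leq_eqVlt nth_rcons size_places.
by case/orP=> [/eqP ->|ltin]; rewrite ?ltnn ?eqxx // ltin IH.
Qed.

Lemma embedE n : (1 < n)%N -> embed n =
  (\big[Num.max/0]_(i < n | `[< L i n >]) embed i +
   \big[Num.min/1]_(i < n | `[< L n i >]) embed i) / 2.
Proof.
case: n => [|[|n]] // _; rewrite /embed /place /lower /upper.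
by congr ((_ + _) / 2); apply: eq_bigr => i _; rewrite nth_places.
Qed.

Let L_refl i : L i i.
Proof. by case: (L_total i i). Qed.

Lemma embed_le i j : L i j <-> embed i <= embed j.
Proof.
suff H n k l : (k < n)%N -> (l < n)%N -> L k l <-> embed k <= embed l.
  by apply: (H (maxn i j).+1); rewrite ltnS leq_max leqnn ?orbT.
elim: n k l => // -[|[|n]] IH k l.
- by case: k l => [|//] [|//] _ _; rewrite lexx.
- case: k l => [|[|//]] [|[|//]] _ _; rewrite /embed /= ?lexx ?ler01 //.
  by rewrite lt_geF.
have IHlt a b : (a < n.+2)%N -> (b < n.+2)%N -> ~ L b a -> embed a < embed b.
  by move=> an bn; rewrite (IH b a) // => /negP; rewrite ltNge.
have e0 : embed 0 = 0 by [].
have e1 : embed 1 = 1 by [].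
set m := n.+2 in IH IHlt *.
have ge0 a : (a < m)%N -> 0 <= embed a by move=> am; rewrite -e0 -IH.
have le1 a : (a < m)%N -> embed a <= 1 by move=> am; rewrite -e1 -IH.
have key a : (a < m)%N ->
    (L a m <-> embed a <= embed m) /\ (L m a <-> embed m <= embed a).
  move=> am; have em := @embedE m isT.
  set lo := bigop.body _ _ _ in em; set hi := bigop.body _ _ _ in em.
  have lo_ge b : (b < m)%N -> L b m -> embed b <= lo.
    move=> bm Lb; apply: (@le_bigmax_cond _ _ _ _ (Ordinal bm)); exact/asboolP.
  have hi_le b : (b < m)%N -> L m b -> hi <= embed b.
    move=> bm Lb; apply: (@bigmin_le_cond _ _ _ _ (Ordinal bm)); exact/asboolP.
  (* A point equivalent to an earlier one has equal lower and upper neighbours and so gets the same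
     value; otherwise [lo < hi], and the midpoint lies strictly between. *)
  have [[b [bm Lbm Lmb]]|nex] := pselect (exists b, [/\ (b < m)%N, L b m & L m b]).
    have -> : embed m = embed b.
      have -> : embed m = (embed b + embed b) / 2; last by field.
      rewrite em; congr ((_ + _) / 2); apply/le_anti/andP; split.
      - apply: bigmax_le => [|c /asboolP Lc]; first exact: ge0.
        by rewrite -IH //; apply: L_trans Lmb.
      - exact: lo_ge.
      - exact: hi_le.
      - apply: le_bigmin => [|c /asboolP Lc]; first exact: le1.
        by rewrite -IH //; apply: L_trans Lc.
    rewrite -!IH //; split; split=> h; first exact: L_trans Lmb.
    - exact: L_trans Lbm.
    - exact: L_trans h.
    - exact: L_trans h.
  have lohi : lo < hi.
    have sep b c : (b < m)%N -> (c < m)%N -> L b m -> L m c -> embed b < embed c.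
      move=> bm cm Lb Lc; apply: IHlt => // Lcb; apply: nex.
      by exists b; split=> //; apply: L_trans Lcb.
    apply: lt_bigmin => [|c /asboolP Lc]; apply: bigmax_lt => [|b /asboolP Lb].
    - exact: ltr01.
    - by rewrite -e1; apply: sep.
    - by rewrite -e0; apply: sep.
    - exact: sep.
  have [Lam|Lma] := L_total a m.
    have aelo := lo_ge _ am Lam.
    have nLma : ~ L m a by move=> Lma; apply: nex; exists a.
    split; split=> //; lra.
  have haie := hi_le _ am Lma.
  have nLam : ~ L a m by move=> Lam; apply: nex; exists a.
  split; split=> //; lra.
rewrite !ltnS (leq_eqVlt k) (leq_eqVlt l).
move=> /orP[/eqP ->|km] /orP[/eqP ->|lm].
- by rewrite lexx.
- by have [] := key l lm.
- by have [] := key k km.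
- exact: IH.
Qed.

Lemma embed_midpoint : midpoint_sequence embed.
Proof.
move=> n i j ni nj gap /andP[en ne].
have n1 : (1 < n)%N.
  case: n en ne {ni nj gap} => [|[|//]] en ne.
    by have := (embed_le 0 i).1 (L_bot i); rewrite leNgt en.
  by have := (embed_le j 1).1 (L_top j); rewrite leNgt ne.
have ge0 a : 0 <= embed a by exact: (embed_le 0 a).1.
have le1 a : embed a <= 1 by exact: (embed_le a 1).1.
rewrite embedE //; congr ((_ + _) / 2); apply/le_anti/andP; split.
- apply: bigmax_le => // k /asboolP /embed_le kn.
  by case: (gap k) => // jk; move: (lt_le_trans ne jk); rewrite ltNge kn.
- by apply: (@le_bigmax_cond _ _ _ _ (Ordinal ni)); apply/asboolP/embed_le/ltW.
- by apply: (@bigmin_le_cond _ _ _ _ (Ordinal nj)); apply/asboolP/embed_le/ltW.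
- apply: le_bigmin => // k /asboolP /embed_le kn.
  by case: (gap k) => // ki; move: (le_lt_trans ki en); rewrite ltNge kn.
Qed.

End Embedding.

(** * The model *)

(** Makes [fml] countable, so that chain points and tasks can be enumerated. *)
Fixpoint tree_of_fml (a : fml) : GenTree.tree nat :=
  match a with
  | Var k => GenTree.Leaf k
  | Neg a => GenTree.Node 0 [:: tree_of_fml a]
  | Tri a => GenTree.Node 1 [:: tree_of_fml a]
  | And a b => GenTree.Node 2 [:: tree_of_fml a; tree_of_fml b]
  | Or a b => GenTree.Node 3 [:: tree_of_fml a; tree_of_fml b]
  | Imp a b => GenTree.Node 4 [:: tree_of_fml a; tree_of_fml b]
  | Box a => GenTree.Node 5 [:: tree_of_fml a]
  | Dia a => GenTree.Node 6 [:: tree_of_fml a]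
  end.

Fixpoint fml_of_tree (t : GenTree.tree nat) : option fml :=
  match t with
  | GenTree.Leaf k => Some (Var k)
  | GenTree.Node 0 [:: t] => omap Neg (fml_of_tree t)
  | GenTree.Node 1 [:: t] => omap Tri (fml_of_tree t)
  | GenTree.Node 2 [:: t; u] =>
      obind (fun a => omap (And a) (fml_of_tree u)) (fml_of_tree t)
  | GenTree.Node 3 [:: t; u] =>
      obind (fun a => omap (Or a) (fml_of_tree u)) (fml_of_tree t)
  | GenTree.Node 4 [:: t; u] =>
      obind (fun a => omap (Imp a) (fml_of_tree u)) (fml_of_tree t)
  | GenTree.Node 5 [:: t] => omap Box (fml_of_tree t)
  | GenTree.Node 6 [:: t] => omap Dia (fml_of_tree t)
  | _ => None
  end.

Lemma tree_of_fmlK : pcancel tree_of_fml fml_of_tree.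
Proof.
by elim=> [k|a IHa|a IHa|a IHa b IHb|a IHa b IHb|a IHa b IHb|a IHa|a IHa] //=;
  rewrite IHa //= IHb.
Qed.

HB.instance Definition _ := Countable.copy fml (pcan_type tree_of_fmlK).

(** Every number is the 2-adic valuation of arbitrarily large [n], so each task comes up infinitely
    often. *)
Definition task (n : nat) : nat * fml :=
  odflt (0%N, ftop) (unpickle (logn 2 n)).

Definition parent (n : nat) : nat :=
  if ((task n).1 < n)%N then (task n).1 else 0%N.

Lemma parent_lt n : (0 < n)%N -> (parent n < n)%N.
Proof. by rewrite /parent; case: ifP. Qed.

Lemma task_unbounded N k a :
  exists n, [/\ (N < n)%N, parent n = k & (task n).2 = a].
Proof.
(* [2 ^ m * M.*2.+1] has valuation [m], and the choice of [M] makes it exceed both [N] and [k]. *)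
pose m := pickle (k, a); pose M := (N + k)%N.
have Mn : (M < 2 ^ m * M.*2.+1)%N.
  by apply: leq_trans (leq_pmull _ _); rewrite ?expn_gt0 // ltnS -addnn leq_addr.
exists (2 ^ m * M.*2.+1)%N.
have tE : task (2 ^ m * M.*2.+1) = (k, a).
  rewrite /task lognM ?expn_gt0 // pfactorK // logn_coprime ?addn0 ?pickleK //.
  by rewrite coprime2n /= odd_double.
split; first exact: leq_ltn_trans (leq_addr _ _) Mn.
  by rewrite /parent tE (leq_ltn_trans (leq_addl N k) Mn).
by rewrite tE.
Qed.

(** By the last two fields, a point without immediate neighbour on one side is a limit of values
    from that side; this preserves infima and suprema. *)
Record embedding (R : realType) (le : chain_point -> chain_point -> Prop)
    (e : chain_point -> R) : Prop := Embedding {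
  embedding_le : forall x y, le x y <-> e x <= e y;
  embedding_bot : forall k, e (value k fbot) = 0;
  embedding_top : forall k, e (value k ftop) = 1;
  embedding_right : forall x eps, e x < 1 -> 0 < eps ->
    (forall y, e x < e y -> exists z, e x < e z < e y) ->
    exists y, e x < e y < e x + eps;
  embedding_left : forall x eps, 0 < e x -> 0 < eps ->
    (forall y, e y < e x -> exists z, e y < e z < e x) ->
    exists y, e x - eps < e y < e x
}.

Lemma chain_embedding (R : realType) par le :
  chain par le -> exists e : chain_point -> R, embedding le e.
Proof.
move=> C.
(* The bounds come first, as required by [embed]. *)
pose enum n := if n is n'.+1 then
    if n' is n''.+1 then odflt (value 0 fbot) (unpickle n'') else value 0 ftop
  else value 0 fbot.
pose idx (x : chain_point) := (pickle x).+2.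
have enum_idx x : enum (idx x) = x by rewrite /= pickleK.
pose L i j := le (enum i) (enum j).
have L_total i j : L i j \/ L j i by exact: (chain_total C).
have L_trans j i k : L i j -> L j k -> L i k by exact: (chain_trans C).
have L_bot i : L 0 i by exact: (chain_bot C).
have L_top i : L i 1 by exact: (chain_top C).
have L10 : ~ L 1 0 by exact: (world_bot (chain_world C 0)).
have := @embed_midpoint R _ L_total L_trans L_bot L_top L10.
have := @embed_le R _ L_total L_trans L_bot L_top L10.
have : embed R L 0 = 0 by [].
have : embed R L 1 = 1 by [].
move: (embed R L) => f f1 f0 f_le f_mid; exists (f \o idx) => /=.
(* Several indices may enumerate the same point; being equivalent, they get equal values. *)
have fE i : f i = f (idx (enum i)).
  by apply/le_anti/andP; split; apply/f_le; rewrite /L enum_idx; apply: (chain_refl C).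
have e_le x y : le x y <-> f (idx x) <= f (idx y).
  by rewrite -f_le /L !enum_idx.
split=> [//|k|k|x eps x1 eps0 dense|x eps x0 eps0 dense] /=.
- rewrite -f0 (fE 0%N); apply/le_anti/andP; split; apply/e_le/(chain_bot C).
- rewrite -f1 (fE 1%N); apply/le_anti/andP; split; apply/e_le/(chain_top C).
- have [||i] := @midpoint_right_limit R f (idx x) 1 eps f_mid _ _ eps0.
  + by rewrite f1.
  + by move=> i; rewrite (fE i) => /dense[z hz]; exists (idx z).
  + by rewrite (fE i); exists (enum i).
- have [||i] := @midpoint_right_limit R _ (idx x) 0 eps
    (midpoint_sequence_opp f_mid) _ _ eps0.
  + by rewrite f0 ltrN2.
  + move=> i; rewrite (fE i) ltrN2 => /dense[z /andP[z1 z2]].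
    by exists (idx z); rewrite !ltrN2 z1 z2.
  + by rewrite (fE i) => /andP[h1 h2]; exists (enum i); lra.
Qed.

(** * The truth lemma *)

Section TruthLemma.
Variables (R : realType) (le : chain_point -> chain_point -> Prop).
Variable e : chain_point -> R.
Hypotheses (C : chain parent le) (E : embedding le e)
  (wit : forall n, (0 < n)%N -> witness parent n (task n).2 le).

Let e_le x y : le x y <-> e x <= e y.
Proof. exact: (embedding_le E). Qed.

Let e_nle x y : ~ le x y <-> e y < e x.
Proof. by rewrite e_le ltNge; split=> /negP. Qed.

Let e_bot k : e (value k fbot) = 0.
Proof. exact: (embedding_bot E). Qed.

Let e_top k : e (value k ftop) = 1.
Proof. exact: (embedding_top E). Qed.

Let e01 x : 0 <= e x <= 1.
Proof.
rewrite -(e_bot 0) -(e_top 0); apply/andP; split; apply/e_le.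
  exact: (chain_bot C).
exact: (chain_top C).
Qed.

Definition tree_acc (i j : nat) : R :=
  if (0 < j)%N && (parent j == i) then e (edge j) else 0.

Lemma tree_acc01 i j : 0 <= tree_acc i j <= 1.
Proof. by rewrite /tree_acc; case: ifP => // _; rewrite lexx ler01. Qed.

Definition tree_frame : fuzzy_frame R :=
  FuzzyFrame (inhabits 0%N) tree_acc01.

Definition tree_model : model R :=
  @Model R tree_frame (fun p (w : tree_frame) => e (value w (Var p)))
    (fun p w => e01 (value w (Var p))).

Let e_true k a : truth le k a -> e (value k a) = 1.
Proof.
move=> ka; apply/le_anti; case/andP: (e01 (value k a)) => _ -> /=.
rewrite -(e_top k); apply/e_le; exact: ka.
Qed.

Let e_false k a : truth le k (a ⊃ fbot)%F -> e (value k a) = 0.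
Proof.
move=> /(chain_le C) /e_le; rewrite e_bot => h; apply/le_anti.
by case/andP: (e01 (value k a)) => -> _; rewrite h.
Qed.

Let e_imp k a b : e (value k (a ⊃ b)%F) = gimp (e (value k a)) (e (value k b)).
Proof.
rewrite /gimp; case: ifPn => [/e_le/(chain_imp C)/e_true //|/negP nab].
have tk := truth_theory C k.
apply/le_anti/andP; split; apply/e_le; last by apply: (chain_le C); apply: in_K.
by have [/(chain_le C)/e_le|] := chain_imp_or C k a b.
Qed.

Let e_and k a b : e (value k (a ⊓ b)%F) = gand (e (value k a)) (e (value k b)).
Proof.
have tk := truth_theory C k; apply/le_anti; rewrite /gand le_min.
have -> : e (value k (a ⊓ b)%F) <= e (value k a).
  by apply/e_le; apply: (chain_le C); apply: in_andl.
have -> /= : e (value k (a ⊓ b)%F) <= e (value k b).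
  by apply/e_le; apply: (chain_le C); apply: in_andr.
rewrite ge_min; apply/orP.
by have [ab|ba] := world_total (chain_world C k) a b; [left|right];
  apply/e_le; apply: (chain_le C); apply: in_and_intro => //; apply: in_id.
Qed.

Let e_or k a b : e (value k (a ⊔ b)%F) = gor (e (value k a)) (e (value k b)).
Proof.
have tk := truth_theory C k; apply/le_anti; rewrite /gor ge_max.
have -> : e (value k a) <= e (value k (a ⊔ b)%F).
  by apply/e_le; apply: (chain_le C); apply: in_orl.
have -> /= : e (value k b) <= e (value k (a ⊔ b)%F).
  by apply/e_le; apply: (chain_le C); apply: in_orr.
rewrite andbT le_max; apply/orP.
by have [ab|ba] := world_total (chain_world C k) a b; [right|left];
  apply/e_le; apply: (chain_le C); apply: in_or_elim => //; apply: in_id.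
Qed.

Let e_neg k a : e (value k (∼ a)%F) = gneg (e (value k a)).
Proof.
have wk := chain_world C k; rewrite /gneg.
have [ka|nka] := pselect (truth le k (a ⊃ fbot)%F).
  by rewrite (e_false ka) eqxx e_true //; apply: (world_neg wk).
rewrite (e_false (world_nneg wk nka)); case: eqP => // a0; case: nka.
by apply: (chain_imp C k a fbot).1; apply/e_le; rewrite a0 e_bot.
Qed.

Let e_tri k a : e (value k (△ a)%F) = gtri (e (value k a)).
Proof.
have wk := chain_world C k; rewrite /gtri.
have [ka|nka] := pselect (truth le k a).
  by rewrite (e_true ka) eqxx e_true //; apply: (world_tri wk).
rewrite (e_false (world_ntri wk nka)); case: eqP => // a1; case: nka.
by apply/(e_le (value k ftop)); rewrite a1 e_top.
Qed.

Let box_ge k j a : e (value k (□ a)%F) <= gimp (tree_acc k j) (e (value j a)).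
Proof.
have /andP[_ k1] := e01 (value k (□ a)%F).
rewrite /gimp; case: ifPn => // /negP; rewrite /tree_acc.
case: ifP => [/andP[j0 /eqP <-] nle|_ []]; last by case/andP: (e01 (value j a)).
by have [/e_le h|/e_le] := chain_box C a j0; first by case: nle.
Qed.

Let dia_le k j a : gand (tree_acc k j) (e (value j a)) <= e (value k (◇ a)%F).
Proof.
have /andP[k0 _] := e01 (value k (◇ a)%F).
rewrite /gand ge_min /tree_acc.
case: ifP => [/andP[j0 /eqP <-]|_]; last by rewrite k0.
by have [/e_le ->|/e_le ->] := chain_dia C a j0; rewrite ?orbT.
Qed.

Let box_witness k a x : e (value k (□ a)%F) < 1 -> e (value k (□ a)%F) < e x ->
  exists j, gimp (tree_acc k j) (e (value j a)) = e (value j a) /\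
    e (value j a) < e x.
Proof.
move=> k1 kx; have [n [xn pn tn]] := task_unbounded x.1 k (□ a)%F.
have n0 : (0 < n)%N by case: (n) xn.
have := wit n0; rewrite tn /= pn => -[/e_true e1|[/e_nle ea H]].
  by rewrite e1 ltxx in k1.
exists n; split; last by apply/e_nle/H => //; apply/e_nle.
by rewrite /tree_acc n0 pn eqxx /gimp leNgt ea.
Qed.

Let dia_witness k a x : 0 < e (value k (◇ a)%F) -> e x < e (value k (◇ a)%F) ->
  exists j, e x < gand (tree_acc k j) (e (value j a)).
Proof.
move=> k0 kx; have [n [xn pn tn]] := task_unbounded x.1 k (◇ a)%F.
have n0 : (0 < n)%N by case: (n) xn.
have := wit n0; rewrite tn /= pn => -[/e_le|H].
  by rewrite e_bot leNgt k0.
have [/e_nle h1 /e_nle h2] := H x xn ((e_nle _ _).2 kx).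
by exists n; rewrite /tree_acc n0 pn eqxx /gand lt_min h1.
Qed.

Let e_box k a : inf [set gimp (tree_acc k j) (e (value j a)) | j in [set: nat]] =
  e (value k (□ a)%F).
Proof.
set S := [set _ | _ in _].
have lbS : lbound S (e (value k (□ a)%F)) by move=> _ [j _ <-]; apply: box_ge.
have S0 : S !=set0 by exists (gimp (tree_acc k 0) (e (value 0 a))), 0%N.
have inf_le j : inf S <= gimp (tree_acc k j) (e (value j a)).
  by apply: ge_inf; [exists (e (value k (□ a)%F)) | exists j].
apply/le_anti; rewrite lb_le_inf // andbT.
have [k1|k1] := leP 1 (e (value k (□ a)%F)).
  apply: le_trans (le_trans (inf_le 0%N) _) k1; rewrite /gimp; case: ifP => // _.
  by case/andP: (e01 (value 0 a)).
have [[j je]|nex] := pselect (exists j, gimp (tree_acc k j) (e (value j a))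
    <= e (value k (□ a)%F)); first exact: le_trans (inf_le j) je.
have lt_value j : e (value k (□ a)%F) < gimp (tree_acc k j) (e (value j a)).
  by rewrite ltNge; apply/negP => h; apply: nex; exists j.
apply/ler_addgt0Pr => eps eps0.
have [|y /andP[ky yeps]] := embedding_right E k1 eps0.
  move=> y ky; have [j [je jy]] := box_witness k1 ky.
  by exists (value j a); rewrite jy -je lt_value.
have [j [je jy]] := box_witness k1 ky.
by apply: le_trans (inf_le j) _; rewrite je; apply/ltW/(lt_trans jy).
Qed.

Let e_dia k a : sup [set gand (tree_acc k j) (e (value j a)) | j in [set: nat]] =
  e (value k (◇ a)%F).
Proof.
set S := [set _ | _ in _].
have ubS : ubound S (e (value k (◇ a)%F)) by move=> _ [j _ <-]; apply: dia_le.
have S0 : S !=set0 by exists (gand (tree_acc k 0) (e (value 0 a))), 0%N.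
have le_sup j : gand (tree_acc k j) (e (value j a)) <= sup S.
  by apply: ub_le_sup; [exists (e (value k (◇ a)%F)) | exists j].
apply/le_anti; rewrite ge_sup //=.
have [k0|k0] := leP (e (value k (◇ a)%F)) 0.
  apply: le_trans k0 (le_trans _ (le_sup 0%N)); rewrite /gand le_min.
  by case/andP: (tree_acc01 k 0) => -> _; case/andP: (e01 (value 0 a)).
have [[j je]|nex] := pselect (exists j, e (value k (◇ a)%F) <=
    gand (tree_acc k j) (e (value j a))); first exact: le_trans (le_sup j).
apply/ler_addgt0Pr => eps eps0.
have attained j : exists z, e z = gand (tree_acc k j) (e (value j a)).
  rewrite /gand /tree_acc; case: ifP => _; rewrite /Num.min; case: ifP => _.
  - by exists (edge j).
  - by exists (value j a).
  - by exists (value 0 fbot).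
  - by exists (value j a).
have [|y /andP[yeps yk]] := embedding_left E k0 eps0.
  move=> y yk; have [j jy] := dia_witness k0 yk; have [z ez] := attained j.
  exists z; rewrite ez jy /= ltNge; apply/negP => h; apply: nex.
  by exists j.
have [j jy] := dia_witness k0 yk; have := le_sup j; lra.
Qed.

Lemma eval_tree_model (a : fml) (k : tree_model) : eval a k = e (value k a).
Proof.
elim: a k => [p|a IHa|a IHa|a IHa b IHb|a IHa b IHb|a IHa b IHb|a IHa|a IHa] k /=.
- by [].
- by rewrite IHa e_neg.
- by rewrite IHa e_tri.
- by rewrite IHa IHb e_and.
- by rewrite IHa IHb e_or.
- by rewrite IHa IHb e_imp.
- by rewrite -e_box; congr inf; apply: eq_imagel => j _; rewrite IHa.
- by rewrite -e_dia; congr sup; apply: eq_imagel => j _; rewrite IHa.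
Qed.

End TruthLemma.

(** * Soundness *)

Ltac no_if t :=
  lazymatch t with context [if _ then _ else _] => fail | _ => idtac end.

Ltac decide_le x y :=
  match goal with
  | _ => rewrite (lexx x)
  | _ => first [rewrite (@ler10 _) | rewrite (@ler01 _)]
  | H : is_true (x <= y) |- _ => rewrite H
  | H : is_true (x < y) |- _ => rewrite (ltW H)
  | H : is_true (y < x) |- _ => rewrite (lt_geF H)
  | _ => case: (leP x y) => ?
  end.

Ltac decide_eq x y :=
  match goal with
  | _ => rewrite (eqxx x)
  | _ => rewrite (@oner_eq0 _)
  | H : is_true (x < y) |- _ => rewrite (lt_eqF H)
  | H : is_true (y < x) |- _ => rewrite (gt_eqF H)
  | _ => case: (ltgtP x y) => ?; try (exfalso; lra)
  end.

Ltac goedel :=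
  rewrite /gimp /gand /gor /gneg /gtri ?minEle ?maxEle;
  repeat (match goal with |- context [if ?t then _ else _] =>
    no_if t; match t with
    | (?x <= ?y) => decide_le x y
    | (?x == ?y) => decide_eq x y
    end
  end; cbv iota); move=> *; first [exact: lexx | assumption | lra].

Section Soundness.
Variables (R : realType) (M : model R).
Implicit Types (a b : fml) (w : M) (c : R).

Lemma eval01 a w : 0 <= eval a w <= 1.
Proof.
elim: a w => [p|a IHa|a IHa|a IHa b IHb|a IHa b IHb|a IHa b IHb|a IHa|a IHa] w /=;
  try by move: (IHa w) => /andP[? ?]; try move: (IHb w) => /andP[? ?]; goedel.
- exact: valu01.
- have S0 : [set gimp (acc w w') (eval a w') | w' in [set: M]] !=set0.
    by exists (gimp (acc w w) (eval a w)), w.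
  have lb : lbound [set gimp (acc w w') (eval a w') | w' in [set: M]] 0.
    by move=> _ [v _ <-]; move: (IHa v) => /andP[? ?]; goedel.
  rewrite lb_le_inf //=; apply: le_trans (_ : gimp (acc w w) (eval a w) <= 1).
    by apply: ge_inf; [exists 0 | exists w].
  by move: (IHa w) => /andP[? ?]; goedel.
- have S0 : [set gand (acc w w') (eval a w') | w' in [set: M]] !=set0.
    by exists (gand (acc w w) (eval a w)), w.
  have ub : ubound [set gand (acc w w') (eval a w') | w' in [set: M]] 1.
    by move=> _ [v _ <-]; move: (IHa v) => /andP[? ?]; goedel.
  rewrite ge_sup // andbT; apply: le_trans (_ : gand (acc w w) (eval a w) <= _).
    by move: (IHa w) (acc01 w w) => /andP[? ?] /andP[? ?]; goedel.
  by apply: ub_le_sup; [exists 1 | exists w].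
Qed.

Lemma le_gimp (x y z : R) : x <= 1 -> (x <= gimp y z) = (Num.min x y <= z).
Proof. by move=> x1; apply/idP/idP; goedel. Qed.

Lemma le_box a w c : c <= 1 ->
  c <= eval (□ a)%F w <-> forall v, Num.min c (acc w v) <= eval a v.
Proof.
move=> c1 /=; split=> [h v|h].
  rewrite -le_gimp //; apply: le_trans h _; apply: ge_inf; last by exists v.
  by exists 0 => _ [u _ <-]; move: (eval01 a u) => /andP[? ?]; goedel.
apply: lb_le_inf; first by exists (gimp (acc w w) (eval a w)), w.
by move=> _ [v _ <-]; rewrite le_gimp.
Qed.

Lemma dia_le_iff a w c :
  eval (◇ a)%F w <= c <-> forall v, Num.min (acc w v) (eval a v) <= c.
Proof.
split=> /= [h v|h].
  apply: le_trans h; apply: ub_le_sup; last by exists v.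
  by exists 1 => _ [u _ <-]; move: (eval01 a u) => /andP[? ?]; goedel.
apply: ge_sup; first by exists (gand (acc w w) (eval a w)), w.
move=> _ [v _ <-]; exact: h.
Qed.

Lemma eval_impE a b w : eval (a ⊃ b)%F w = gimp (eval a w) (eval b w).
Proof. by []. Qed.

Lemma eval_orE a b w : eval (a ⊔ b)%F w = gor (eval a w) (eval b w).
Proof. by []. Qed.

Lemma eval_imp a b w : 1 <= eval (a ⊃ b)%F w <-> eval a w <= eval b w.
Proof.
rewrite /= le_gimp //.
by move: (eval01 a w) => /andP[? ?]; rewrite min_r //; split.
Qed.

Lemma sound_HGtri (s : nat -> fml) (p : pfml) w :
  HGtri_thm p -> 1 <= eval (psubst s p) w.
Proof.
elim=> {p} [p ax|p q _ IHp _ IHq|p _ IHp]; last 2 first.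
- by apply: le_trans IHp _; apply/eval_imp.
- by move: IHp (eval01 (psubst s p) w) => /= ? /andP[? ?]; goedel.
case: ax => [a b c|a b|a b|a b c|a b|a b|a b c|a b c|a b c|a b|a|a b|a|a b|a b|a|a] /=.
all: move: (eval01 (psubst s a) w); move: (eval (psubst s a) w) => x /andP[? ?].
all: try (move: (eval01 (psubst s b) w); move: (eval (psubst s b) w) => y /andP[? ?]).
all: try (move: (eval01 (psubst s c) w); move: (eval (psubst s c) w) => z /andP[? ?]).
all: try (move: (eval01 (s 0%N) w); move: (eval (s 0%N) w) => y /andP[? ?]).
all: rewrite ?le_gimp ?ge_min ?lexx //.
all: goedel.
Qed.

Lemma sound_axiom a w : HKbiG_axiom a -> 1 <= eval a w.
Proof.
case=> {a} [s p /(sound_HGtri s w) //||a b|a b|a b|a b].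
- suff h : eval (◇ fbot)%F w <= 0.
    suff : 1 <= gneg (eval (◇ fbot)%F w) by [].
    by move: (eval01 (◇ fbot)%F w) h; move: (eval _ w) => x /andP[? ?] ?; goedel.
  apply/dia_le_iff => v; move: (acc01 w v) => /andP[? ?] /=.
  by rewrite /gneg /gimp lexx oner_eq0 min_r.
- have /andP[_ k1] := eval01 (□ (a ⊃ b))%F w.
  have /andP[_ a1] := eval01 (□ a)%F w.
  apply/eval_imp; rewrite eval_impE le_gimp //.
  apply/le_box => [|v]; first by rewrite ge_min a1 orbT.
  move: ((le_box (a ⊃ b)%F w k1).1 (lexx _) v).
  move: ((le_box a w a1).1 (lexx _) v).
  by rewrite !eval_impE; goedel.
- apply/eval_imp/dia_le_iff => v.
  move: ((dia_le_iff a w (eval (◇ a)%F w)).1 (lexx _) v).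
  move: ((dia_le_iff b w (eval (◇ b)%F w)).1 (lexx _) v).
  rewrite !eval_orE; move: (eval (◇ a)%F w) (eval (◇ b)%F w).
  by move: (acc w v) (eval a v) (eval b v) => r x y X Y; goedel.
- have /andP[_ a1] := eval01 (□ a)%F w; have /andP[_ b1] := eval01 (◇ b)%F w.
  apply/eval_imp/dia_le_iff => v.
  move: ((le_box a w a1).1 (lexx _) v).
  move: ((dia_le_iff b w (eval (◇ b)%F w)).1 (lexx _) v).
  rewrite !eval_impE; move: (eval (□ a)%F w) (eval (◇ b)%F w) a1 b1.
  by move: (acc w v) (eval a v) (eval b v) => r x y X Y; goedel.
- have /andP[_ i1] := eval01 (◇ a ⊃ □ b)%F w; have /andP[_ b1] := eval01 (□ b)%F w.
  apply/eval_imp/le_box => // v; move: (eval01 b v) => /andP[_].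
  move: ((dia_le_iff a w (eval (◇ a)%F w)).1 (lexx _) v).
  move: ((le_box b w b1).1 (lexx _) v).
  rewrite !eval_impE; move: (eval (◇ a)%F w) (eval (□ b)%F w) b1.
  by move: (acc w v) (eval a v) (eval b v) => r x y X Y; goedel.
Qed.

End Soundness.

Lemma derives_sound (R : realType) (Gamma : set fml) (a : fml) : derives Gamma a ->
  forall (M : model R) (w : M) (c : R), c <= 1 ->
    (forall b, Gamma b -> c <= eval b w) -> c <= eval a w.
Proof.
elim=> {Gamma a} [Gamma a Ga|Gamma a ax|Gamma a b _ IHa _ IHab|Gamma a _ IHa|
  Gamma a _ IHa|Gamma a b _ IHab] M w c c1 cG.
- exact: cG.
- exact: le_trans c1 (sound_axiom w ax).
- have := IHa M w c c1 cG; have := IHab M w c c1 cG; rewrite !eval_impE.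
  by rewrite le_gimp //; goedel.
- have h : 1 <= eval a w by apply: IHa.
  by move: (eval01 a w) h c1 => /andP[_] /=; goedel.
- apply/le_box => // v; have h : 1 <= eval a v by apply: IHa.
  by move: h c1; goedel.
- apply: le_trans c1 _; apply/eval_imp/dia_le_iff => v.
  have ab : eval a v <= eval b v by apply/eval_imp/IHab.
  by move: ((dia_le_iff b w (eval (◇ b)%F w)).1 (lexx _) v) ab; goedel.
Qed.

Theorem theorem3p11 (R : realType) (Gamma : set fml) (phi : fml) :
  entails R Gamma phi <-> derives Gamma phi.
Proof.
split=> [G_phi|d M w]; last first.
  have lb : lbound (1 |` [set eval psi w | psi in Gamma]) 0.
    by move=> _ [->|[a _ <-]]; [exact: ler01 | case/andP: (eval01 a w)].
  apply: (derives_sound d) => [|a Ga]; apply: ge_inf; try by exists 0.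
    by left.
  by right; exists a.
apply: contrapT => nd.
have [|||F [F_prime GF FI]] :=
  @prime_extension _ [set phi] (theory_derives Gamma).
- by move=> a Ga /= ea; apply: nd; rewrite -ea.
- by exists phi.
- move=> a b -> ->; exists phi; split=> //; exact: (in_id (theory_derives set0)).
have [le [C root wit]] := witnessed_chain (fun n => (task n).2) parent_lt F_prime.
have [e E] := chain_embedding R C.
have evalE := @eval_tree_model R le e C E wit.
apply: (FI phi) => //; apply/root/(embedding_le E).
rewrite -evalE; apply: le_trans (G_phi _ _).
apply: lb_le_inf; first by exists 1; left.
move=> _ [->|[a Ga <-]].
  by rewrite -(embedding_top E 0); apply/(embedding_le E)/(chain_top C).
by rewrite evalE; apply/(embedding_le E)/root/GF/der_hyp.
Qed.
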